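(* Let $m\in\mathbb{N}$ and let $(X_i)_{i\in\mathbb{N}}$ be identically distributed elements of a noncommutative probability space $(\mathcal{A},\phi)$ which are $m$-monotone w.r.t. $\phi$, with $\phi(X_i)=0$, $\phi(X_i^2)=1$. For $f=\chi_{(s,t]}\in\Theta$ put $S_N(f)=\frac{1}{\sqrt{N}}\sum_{i=[sN]+1}^{[tN]}X_i$. Let $f_1,\dots,f_n\in\Theta$ have pairwise identical or disjoint supports, let $\sigma=\{\sigma_1,\dots,\sigma_p\}$ be the partition of $\{1,\dots,n\}$ in which $j,l$ lie in the same block iff $f_j=f_l$, and let $b_k=|\sigma_k|/2$. Then $$\lim_{N\to\infty}\phi(S_N(f_1)S_N(f_2)\cdots S_N(f_n))=\frac{1}{b_1!b_2!\cdots b_p!}\sum_{\substack{P\in\mathcal{ONC}^2_n(m)\\ P\sim(f_1,\dots,f_n)}}\ \prod_{\{\alpha,\beta\}\in P}\langle f_\alpha,f_\beta\rangle,$$ with the understanding that $\mathcal{ONC}^2_n(m)=\emptyset$ for $n$ odd (so the right side is $0$).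
   Context: $\Theta=\{\chi_{(s,t]}:0\le s<t<\infty\}$, with $\langle\cdot,\cdot\rangle$ the inner product of $L^2(\mathbb{R}_+)$. Partial order on $\Theta$: $\chi_{(s_1,t_1]}<\chi_{(s_2,t_2]}$ iff $t_1\le s_2$; $f\le g$ iff $f<g$ or $f=g$. An ordered partition $P=(P_1,\dots,P_k)$ of $\{1,\dots,n\}$ is compatible with $(f_1,\dots,f_n)$, written $P\sim(f_1,\dots,f_n)$, if (1) $i,j\in P_k\Rightarrow f_i=f_j$, and (2) $i\in P_k$, $j\in P_l$, $k<l\Rightarrow f_i\le f_j$. An ordered partition of $\{1,\dots,n\}$ is a tuple $P=(P_1,\dots,P_k)$ of pairwise disjoint nonempty sets (blocks) with union $\{1,\dots,n\}$; the index $r$ is the order (color) of $P_r$. $P$ is non-crossing if there are no $s<r<s'<r'$ with $s,s'\in P_i$, $r,r'\in P_j$, $i\ne j$. Block $P_i$ is inner w.r.t. $P_j$ (written $P_j<P_i$) if there are $p<q$ in $P_j$ with no element of $P_j$ strictly between them and $p<s<q$ for all $s\in P_i$. The depth $d(P_i)$ is $1$ plus the number of blocks w.r.t. which $P_i$ is inner. $\mathcal{ONC}_n(m)$ is the set of ordered non-crossing partitions with: $d(P_j)\ge m$ and $P_j<P_i$ imply $j<i$; $\mathcal{ONC}^2_n(m)$ its subset with all blocks of size two. $m$-monotonicity: let $I$ be linearly ordered, $\{\mathcal{A}_i\}_{i\in I}$ $*$-subalgebras of $\mathcal{A}$, $1_i\in\mathcal{A}_i$ projections which are units of $\mathcal{A}_i$.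 $\{1_i\}$ is an $m$-monotone family of units w.r.t. $\phi$ if $\phi(1_i)=1$ and, for all $n$, $1\le j\le n$, indices $i_1,\dots,i_n$, $a_k\in\mathcal{A}_{i_k}\cap\mathrm{Ker}\,\phi$ ($k<j$), $a_k\in\mathcal{A}_{i_k}$ ($k>j$): $\phi(a_1\cdots a_{j-1}1_{i_j}a_{j+1}\cdots a_n)=\phi(a_1\cdots a_{j-1}a_{j+1}\cdots a_n)$ if $j\le m$ or $m<j\le r$ for some $r$ with $i_1\ne\cdots\ne i_m<i_{m+1}<\cdots<i_r>i_{r+1}$, and $=0$ otherwise. $\{\mathcal{A}_i\}$ are $m$-monotone w.r.t. $\phi$ if such units exist and $\phi(a_1\cdots a_n)=0$ whenever $a_k\in\mathcal{A}_{i_k}\cap\mathrm{Ker}\,\phi$ and $i_1\ne i_2\ne\cdots\ne i_n$. $(X_i)_{i\in\mathbb{N}}$ are $m$-monotone if $X_i\in\mathcal{A}_i$ for $m$-monotone $*$-subalgebras $\{\mathcal{A}_i\}_{i\in\mathbb{N}}$. Identically distributed means $\phi(X_i^k)$ is independent of $i$. *)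

(* Defs.v *)
From HB Require Import structures.
From mathcomp Require Import all_boot all_order all_algebra.
From mathcomp Require Import all_classical all_reals all_analysis.
From mathcomp Require Import complex.
Set Implicit Arguments.
Unset Strict Implicit.
Unset Printing Implicit Defensive.
Import Order.TTheory GRing.Theory Num.Theory.
Local Open Scope ring_scope.
Local Open Scope complex_scope.

Definition is_star (R : realType) (A : algType R[i]) (star : A -> A) : Prop :=
  [/\ (forall x y, star (x + y) = star x + star y),
      (forall (c : R[i]) x, star (c *: x) = c^* *: star x),
      (forall x y, star (x * y) = star y * star x) &
      (forall x, star (star x) = x)].

Definition ncps (R : realType) (A : algType R[i]) (phi : A -> R[i]) : Prop :=
  (forall (c : R[i]) x y, phi (c *: x + y) = c * phi x + phi y) /\ phi 1 = 1.

(* B is a *-subalgebra of A (not necessarily containing 1_A). *)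
Definition star_subalg (R : realType) (A : algType R[i]) (star : A -> A)
    (B : A -> Prop) : Prop :=
  [/\ B 0, (forall x y, B x -> B y -> B (x + y)),
      (forall (c : R[i]) x, B x -> B (c *: x)),
      (forall x y, B x -> B y -> B (x * y)) &
      (forall x, B x -> B (star x))].

Definition is_projection (R : realType) (A : algType R[i]) (star : A -> A)
    (p : A) : Prop := star p = p /\ p * p = p.

Definition unit_of (R : realType) (A : algType R[i]) (B : A -> Prop) (u : A)
  : Prop := B u /\ (forall x, B x -> u * x = x /\ x * u = x).

(* positions are 1..n ; i_1 <> i_2 <> ... <> i_n *)
Definition alternating (i : nat -> nat) (n : nat) : Prop :=
  forall k, (1 <= k)%N -> (k < n)%N -> i k <> i k.+1.

Definition prod_with_unit (R : realType) (A : algType R[i]) (a : nat -> A)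
    (u : A) (j n : nat) : A :=
  \prod_(1 <= k < n.+1) (if k == j then u else a k).

Definition prod_without (R : realType) (A : algType R[i]) (a : nat -> A)
    (j n : nat) : A :=
  \prod_(1 <= k < n.+1 | k != j) a k.

Definition unit_removable (m : nat) (i : nat -> nat) (j n : nat) : Prop :=
  (j <= m)%N \/
  exists r : nat, [/\ [/\ (m < j)%N, (j <= r)%N & (r < n)%N],
     (forall k, (1 <= k)%N -> (k < m)%N -> i k <> i k.+1),
     (forall k, (1 <= k)%N -> (m <= k)%N -> (k < r)%N -> (i k < i k.+1)%N) &
     (i r.+1 < i r)%N].

Definition mmonotone_units (R : realType) (A : algType R[i]) (m : nat)
    (phi : A -> R[i]) (star : A -> A) (Asub : nat -> A -> Prop)
    (u : nat -> A) : Prop :=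
  (forall i, [/\ is_projection star (u i), unit_of (Asub i) (u i) &
                 phi (u i) = 1]) /\
  (forall (n j : nat) (i : nat -> nat) (a : nat -> A),
     (1 <= j)%N -> (j <= n)%N -> alternating i n ->
     (forall k, (1 <= k)%N -> (k <= n)%N -> k <> j -> Asub (i k) (a k)) ->
     (forall k, (1 <= k)%N -> (k < j)%N -> phi (a k) = 0) ->
     (unit_removable m i j n ->
        phi (prod_with_unit a (u (i j)) j n) = phi (prod_without a j n)) /\
     (~ unit_removable m i j n ->
        phi (prod_with_unit a (u (i j)) j n) = 0)).

Definition mmonotone (R : realType) (A : algType R[i]) (m : nat)
    (phi : A -> R[i]) (star : A -> A) (Asub : nat -> A -> Prop) : Prop :=
  [/\ (forall i, star_subalg star (Asub i)),
      (exists u, mmonotone_units m phi star Asub u) &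
      (forall (n : nat) (i : nat -> nat) (a : nat -> A),
         (1 <= n)%N -> alternating i n ->
         (forall k, (1 <= k)%N -> (k <= n)%N ->
            Asub (i k) (a k) /\ phi (a k) = 0) ->
         phi (\prod_(1 <= k < n.+1) a k) = 0)].

Definition mmonotone_elems (R : realType) (A : algType R[i]) (m : nat)
    (phi : A -> R[i]) (star : A -> A) (X : nat -> A) : Prop :=
  exists Asub : nat -> A -> Prop,
    mmonotone m phi star Asub /\ (forall i, Asub i (X i)).

Definition ident_distributed (R : realType) (A : algType R[i])
    (phi : A -> R[i]) (X : nat -> A) : Prop :=
  forall (k i j : nat), phi (X i ^+ k) = phi (X j ^+ k).

Definition chi (R : realType) (s t : R) : R -> R := \1_(`]s, t]%classic).

Definition in_Theta (R : realType) (s t : R) : Prop := 0 <= s /\ s < t.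

Definition supp (R : realType) (f : R -> R) : set R := [set x | f x != 0].

Definition ipL2 (R : realType) (f g : R -> R) : R :=
  fine (\int[(@lebesgue_measure R)]_(x in `[0%R, +oo[%classic) (f x * g x)%:E).

(* partial order on Theta: chi_(s1,t1] < chi_(s2,t2] iff t1 <= s2 *)
Definition theta_lt (R : realType) (s1 t1 s2 t2 : R) : Prop := t1 <= s2.
Definition theta_le (R : realType) (s1 t1 s2 t2 : R) : Prop :=
  theta_lt s1 t1 s2 t2 \/ chi s1 t1 = chi s2 t2.

Definition S_N (R : realType) (A : algType R[i]) (X : nat -> A)
    (N : nat) (s t : R) : A :=
  ((Num.sqrt (N%:R : R))^-1)%:C *:
    \sum_((Num.truncn (s * N%:R)).+1 <= k < (Num.truncn (t * N%:R)).+1) X k.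

(* Ordered partitions of {1..n} (encoded as 'I_n, i.e. 0..n-1) into k
   blocks, encoded by the colouring c : 'I_n -> 'I_k; the block P_r
   (of order/colour r) is c^{-1}(r).                                   *)

Section OrdPart.
Variables (n k : nat) (c : {ffun 'I_n -> 'I_k}).

Definition ordpart : bool := [forall r : 'I_k, exists x : 'I_n, c x == r].

Definition noncrossing : bool :=
  [forall s : 'I_n, forall r : 'I_n, forall s' : 'I_n, forall r' : 'I_n,
    [&& (s < r)%N, (r < s')%N, (s' < r')%N, c s == c s' & c r == c r'] ==> (c s == c r)].

Definition inner (j i : 'I_k) : bool :=
  [exists p : 'I_n, exists q : 'I_n,
    [&& (p < q)%N, c p == j, c q == j,
        [forall x : 'I_n, ((p < x)%N && (x < q)%N) ==> (c x != j)] &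
        [forall s : 'I_n, (c s == i) ==> ((p < s)%N && (s < q)%N)]]].

Definition depth (i : 'I_k) : nat := #|[set j : 'I_k | inner j i]|.+1.

Definition ONC (m : nat) : bool :=
  [&& ordpart, noncrossing &
      [forall j : 'I_k, forall i : 'I_k,
         ((m <= depth j)%N && inner j i) ==> (j < i)%N]].

Definition pair_part : bool :=
  [forall r : 'I_k, #|[set x : 'I_n | c x == r]| == 2].

Definition ONC2 (m : nat) : bool := ONC m && pair_part.

End OrdPart.

Definition compatible (R : realType) (n k : nat) (c : {ffun 'I_n -> 'I_k})
    (s t : 'I_n -> R) : Prop :=
  (forall x y, c x = c y -> chi (s x) (t x) = chi (s y) (t y)) /\
  (forall x y, (c x < c y)%N -> theta_le (s x) (t x) (s y) (t y)).

Definition sigma_part (R : realType) (n : nat) (s t : 'I_n -> R)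
  : {set {set 'I_n}} :=
  [set [set l : 'I_n | `[< chi (s j) (t j) = chi (s l) (t l) >]] | j : 'I_n].

Definition clt_rhs (R : realType) (m n : nat) (s t : 'I_n -> R) : R :=
  (\prod_(B in sigma_part s t) ((#|B| %/ 2)`!)%:R)^-1 *
  \sum_(k < n.+1)
    \sum_(c : {ffun 'I_n -> 'I_k} | ONC2 c m && `[< compatible c s t >])
      \prod_(a : 'I_n) \prod_(b : 'I_n | (a < b)%N && (c a == c b))
         ipL2 (chi (s a) (t a)) (chi (s b) (t b)).

(* Main.v *)
Require Import Defs.
From HB Require Import structures.
From mathcomp Require Import all_boot all_order all_algebra.
From mathcomp Require Import all_classical all_reals all_analysis.
From mathcomp Require Import complex.
From mathcomp Require Import zify lra.
Set Implicit Arguments.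
Unset Strict Implicit.
Unset Printing Implicit Defensive.
Import Order.TTheory GRing.Theory Num.Theory.
Import numFieldNormedType.Exports.
Local Open Scope ring_scope.
Local Open Scope complex_scope.

(** Expand [phi (S_N f_1 ... S_N f_n)] as a normalised sum of the moments
    [phi (X_(i_1) ... X_(i_n))] over index words [i].

    - A word in which some index occurs exactly once has moment 0, and the
      moments of all words of length [n] are bounded uniformly in the indices.
      Hence words that are not pairings use fewer than [n/2] values and
      contribute [O(N^(-1/2))].
    - The moment of a word in which every index occurs exactly twice is
      computed by reading it from the left with a stack.  As long as neighbours
      differ, letters are pushed; when the letter on top is read again, the
      square [X_i^2] is replaced by the unit [1_i], its centered part being a
      singleton.  That unit can be deleted exactly when the indices on the stack
      increase from level [m] on, and otherwise it annihilates the moment.  So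
      the moment is 1 if the pairing, with blocks coloured by the relative order
      of their indices, lies in ONC^2(m), and 0 otherwise.
    - For a fixed compatible ordered pairing, the words inducing it correspond
      to increasing choices of one index per block, in number
      [prod_u C(L_u, b_u)] over the distinct intervals [u], where
      [L_u ~ N |u|]; after division by [N^(n/2)] this tends to
      [prod_u |u|^(b_u) / b_u!]. *)

(** * Moments of words in an m-monotone family *)

Definition alternating_seq (s : seq nat) : bool := sorted (fun a b => a != b) s.

Lemma alternating_rcons s x : alternating_seq (rcons s x) = alternating_seq s && ((s == [::]) || (last 0%N s != x)).
Proof.
case: s => [|y s] //=; rewrite /alternating_seq /= rcons_path.
by case: s.
Qed.

Lemma alternating_rcons_cat s x t :
  alternating_seq (rcons s x) -> alternating_seq t -> ((t == [::]) || (head 0%N t != x)) -> alternating_seq (rcons s x ++ t).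
Proof.
case: s => [|y s] /=; rewrite /alternating_seq; case: t => [|z t] //=.
- by move=> _ -> ; rewrite eq_sym => ->.
- by rewrite cats0.
by rewrite cat_path last_rcons /= => -> ->; rewrite eq_sym => ->.
Qed.

Section Words.
Variables (R : realType) (A : algType R[i]) (star : A -> A) (phi : A -> R[i]).
Variables (m : nat) (Asub : nat -> A -> Prop) (u : nat -> A) (X : nat -> A).
Hypothesis Hphi : ncps phi.
Hypothesis HA : forall i, star_subalg star (Asub i).
Hypothesis Hu : mmonotone_units m phi star Asub u.
Hypothesis Hker : forall (n : nat) (i : nat -> nat) (a : nat -> A),
  (1 <= n)%N -> Defs.alternating i n ->
  (forall k, (1 <= k)%N -> (k <= n)%N -> Asub (i k) (a k) /\ phi (a k) = 0) ->
  phi (\prod_(1 <= k < n.+1) a k) = 0.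
Hypothesis HX : forall i, Asub i (X i).
Hypothesis Hid : ident_distributed phi X.

Local Notation C := R[i].
Local Notation letter := (nat * {poly C})%type.

Lemma phiD x y : phi (x + y) = phi x + phi y.
Proof. by have := Hphi.1 1 x y; rewrite scale1r mul1r. Qed.

Lemma phi0 : phi 0 = 0.
Proof. by apply: (addrI (phi 0)); rewrite -phiD !addr0. Qed.

Lemma phiZ c x : phi (c *: x) = c * phi x.
Proof. by have := Hphi.1 c x 0; rewrite phi0 !addr0. Qed.

Lemma phiN x : phi (- x) = - phi x.
Proof. by rewrite -scaleN1r phiZ mulN1r. Qed.

Lemma phiB x y : phi (x - y) = phi x - phi y.
Proof. by rewrite phiD phiN. Qed.

Lemma phi_sum (I : Type) (r : seq I) (P : pred I) (F : I -> A) :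
  phi (\sum_(i <- r | P i) F i) = \sum_(i <- r | P i) phi (F i).
Proof. by apply: (big_morph phi phiD phi0). Qed.

(* A polynomial is evaluated in the algebra [Asub i], whose unit is [u i] and not 1. *)
Definition eval_letter (i : nat) (q : {poly C}) : A := u i * horner_alg (X i) q.

(** Index 0 stands for any index: by identical distribution the value is the same in every [Asub i],
    see [phi_eval_letter]. *)
Definition mean (q : {poly C}) : C := phi (eval_letter 0 q).

Definition center (q : {poly C}) : {poly C} := q - (mean q)%:P.

Definition wprod (w : seq letter) : A := \prod_(l <- w) eval_letter l.1 l.2.

Lemma unituX i : u i * X i = X i /\ X i * u i = X i.
Proof. by have [_ [_ h] _] := Hu.1 i; exact: h. Qed.

Lemma unituu i : u i * u i = u i.
Proof. by have [[_ h] _ _] := Hu.1 i. Qed.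

(** [horner_alg (X i) q] has its constant term in the ambient 1, where [u i] need not act as a unit.
    It still commutes with [X i] and with scalars, which makes [eval_letter i] multiplicative. *)
Lemma eval_letter_comm i q : u i * horner_alg (X i) q = horner_alg (X i) q * u i.
Proof.
elim/poly_ind: q => [|q c IH]; first by rewrite rmorph0 mulr0 mul0r.
rewrite rmorphD rmorphM /= horner_algX horner_algC mulrDr mulrDl mulrA IH.
by rewrite -!mulrA (unituX i).1 (unituX i).2 -scalerAr mulr1 -scalerAl mul1r.
Qed.

Lemma eval_letterM i p q : eval_letter i (p * q) = eval_letter i p * eval_letter i q.
Proof.
rewrite /eval_letter rmorphM /= [in RHS]eval_letter_comm !mulrA -(mulrA _ (u i) (u i)) unituu.
by rewrite -eval_letter_comm.
Qed.

Lemma eval_letter1 i : eval_letter i 1 = u i.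
Proof. by rewrite /eval_letter rmorph1 mulr1. Qed.

Lemma eval_letterX i : eval_letter i 'X = X i.
Proof. by rewrite /eval_letter horner_algX (unituX i).1. Qed.

Lemma eval_letterD i p q : eval_letter i (p + q) = eval_letter i p + eval_letter i q.
Proof. by rewrite /eval_letter rmorphD mulrDr. Qed.

Lemma eval_letterC i c : eval_letter i c%:P = c *: u i.
Proof. by rewrite /eval_letter horner_algC -scalerAr mulr1. Qed.

Lemma eval_letter_Asub i q : Asub i (eval_letter i q).
Proof.
have [B0 BD BZ BM _] := HA i.
have [_ [Bu _] _] := Hu.1 i.
elim/poly_ind: q => [|q c IH]; first by rewrite /eval_letter rmorph0 mulr0.
by rewrite eval_letterD eval_letterM eval_letterX eval_letterC; apply: BD; [exact: BM|exact: BZ].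
Qed.

Lemma phi_eval_letter i q : phi (eval_letter i q) = mean q.
Proof.
rewrite /mean -[q]coefK poly_def.
have aux j : phi (eval_letter j (\sum_(k < size q) q`_k *: 'X^k)) =
    \sum_(k < size q) q`_k * phi (X j ^+ k).
  rewrite /eval_letter rmorph_sum /= mulr_sumr phi_sum; apply: eq_bigr => k _.
  rewrite -[u j * _]/(eval_letter j _) -mul_polyC eval_letterM eval_letterC -scalerAl phiZ /eval_letter mulrA unituu.
  congr (_ * _).
  (* In degree 0 the letter is [u j] while the moment is that of 1; [phi] takes the value 1 on
     both. *)
  rewrite rmorphXn /= horner_algX; case: (k : nat) => [|k'].
    by rewrite !expr0 mulr1 Hphi.2; have [_ _ ->] := Hu.1 j.
  by rewrite exprS mulrA (unituX j).1.
by rewrite !aux; apply: eq_bigr => k _; rewrite (Hid k i 0).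
Qed.

Lemma meanB p q : mean (p - q) = mean p - mean q.
Proof. by rewrite /mean /eval_letter rmorphB /= mulrBr phiB. Qed.

Lemma meanC c : mean c%:P = c.
Proof. by rewrite /mean eval_letterC phiZ; have [_ _ ->] := Hu.1 0%N; rewrite mulr1. Qed.

Lemma mean_center q : mean (center q) = 0.
Proof. by rewrite /center meanB meanC subrr. Qed.

Lemma wprod_cat w1 w2 : wprod (w1 ++ w2) = wprod w1 * wprod w2.
Proof. by rewrite /wprod big_cat. Qed.

Lemma wprod_cons l w : wprod (l :: w) = eval_letter l.1 l.2 * wprod w.
Proof. by rewrite /wprod big_cons. Qed.

Lemma wprod_nil : wprod [::] = 1.
Proof. by rewrite /wprod big_nil. Qed.

Lemma wprod_merge w1 w2 x p q :
  wprod (w1 ++ (x, p) :: (x, q) :: w2) = wprod (w1 ++ (x, p * q) :: w2).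
Proof. by rewrite !wprod_cat !wprod_cons /= eval_letterM !mulrA. Qed.

(** [q] is its centred part plus a constant, and constants evaluate in [Asub x] to multiples of
    [u x]. *)
Lemma phi_center w1 w2 x q :
  phi (wprod (w1 ++ (x, q) :: w2)) =
  phi (wprod (w1 ++ (x, center q) :: w2)) + mean q * phi (wprod (w1 ++ (x, 1) :: w2)).
Proof.
rewrite -phiZ -phiD !wprod_cat !wprod_cons /= eval_letter1 scalerAr scalerAl -eval_letterC.
by rewrite -mulrDr -mulrDl -eval_letterD subrK.
Qed.

Definition indices (w : seq letter) := [seq l.1 | l <- w].
Definition centered (w : seq letter) := all (fun l : letter => mean l.2 == 0) w.

Lemma wprod_nth w d : wprod w = \prod_(1 <= k < (size w).+1) eval_letter (nth d w k.-1).1 (nth d w k.-1).2.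
Proof. by rewrite big_add1 /= /wprod (big_nth d). Qed.

Lemma alternating_nth (w : seq letter) : alternating_seq (indices w) ->
  Defs.alternating (fun k => nth 0%N (indices w) k.-1) (size w).
Proof.
move=> aw [|k] // _ kw /=; apply/eqP.
have := sortedP 0%N aw k; rewrite size_map; exact.
Qed.

Lemma phi_centered w : w != [::] -> alternating_seq (indices w) -> centered w -> phi (wprod w) = 0.
Proof.
move=> w0 aw kw; rewrite (wprod_nth _ (0%N, 0)).
apply: (Hker (i := fun k => nth 0%N (indices w) k.-1)).
- by case: w w0 {aw kw}.
- exact: alternating_nth.
move=> [|k] //= _ kn; rewrite (nth_map (0%N, 0)) //; split; first exact: eval_letter_Asub.
by rewrite phi_eval_letter; apply/eqP; exact: (all_nthP _ kw).
Qed.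

(** * Removing a unit from a word *)

Definition removable (s : seq nat) j :=
  unit_removable m (fun k => nth 0%N s k.-1) j (size s).

(** The axiom on units, for lists: the unit stands at position [(size w1).+1], counted from 1, and
    only the letters before it have to be centred. *)
Lemma phi_unit w1 w2 x : alternating_seq (indices w1 ++ x :: indices w2) -> centered w1 ->
  (removable (indices w1 ++ x :: indices w2) (size w1).+1 ->
    phi (wprod (w1 ++ (x, 1) :: w2)) = phi (wprod (w1 ++ w2))) /\
  (~ removable (indices w1 ++ x :: indices w2) (size w1).+1 ->
    phi (wprod (w1 ++ (x, 1) :: w2)) = 0).
Proof.
move=> aw kw; set w := w1 ++ (x, 1) :: w2.
have wE : indices w = indices w1 ++ x :: indices w2 by rewrite /indices map_cat.
rewrite -wE in aw *; rewrite /removable size_map.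
pose i k := nth 0%N (indices w) k.-1.
pose d : letter := (0%N, 0).
pose a k := eval_letter (nth d w k.-1).1 (nth d w k.-1).2.
have sw : size w = (size w1 + (size w2).+1)%N by rewrite size_cat.
have ij : i (size w1).+1 = x.
  by rewrite /i wE nth_cat size_map /= ltnn subnn.
have := Hu.2 (size w) (size w1).+1 i a isT _ (alternating_nth aw) _ _.
have -> : prod_with_unit a (u (i (size w1).+1)) (size w1).+1 (size w) = wprod w.
  rewrite (wprod_nth w d) /prod_with_unit; apply: eq_big_nat => k /andP[k0 kn].
  case: eqP => // ->; rewrite /= nth_cat ltnn subnn /= eval_letter1 ij //.
have -> : prod_without a (size w1).+1 (size w) = wprod (w1 ++ w2).
  rewrite /prod_without (@big_cat_nat _ _ _ (size w1).+1) ?sw //=; last lia.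
  rewrite wprod_cat; congr (_ * _).
    rewrite (wprod_nth w1 d) big_nat_cond [RHS]big_nat_cond; apply: eq_big => k.
      by apply/andP/andP => -[]; lia.
    move=> /andP[/andP[k0 k1] _]; rewrite /a /w nth_cat ifT //; lia.
  rewrite big_ltn_cond ?eqxx /=; last lia.
  rewrite (wprod_nth w2 d) -[(size w1).+2](addn1) addnC big_addn.
  rewrite (_ : (_ - _)%N = (size w2).+1); last lia.
  rewrite big_nat_cond [RHS]big_nat_cond; apply: eq_big => k.
    by apply/andP/andP => -[]; lia.
  move=> /andP[/andP[k0 k1] _]; rewrite /a /w nth_cat ifF; last lia.
  rewrite (_ : ((k + (size w1).+1).-1 - size w1)%N = k); last lia.
  by case: k k0 {k1}.
apply.
- by rewrite sw; lia.
- move=> k k1 kn _; rewrite /i /indices (nth_map d); last lia.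
  exact: eval_letter_Asub.
move=> k k1 kj; rewrite /a phi_eval_letter /w nth_cat ifT; last lia.
by apply/eqP; apply: (all_nthP _ kw); lia.
Qed.

(** Beyond level [m] a removable unit needs a descent at or after its position, but here the indices
    ascend up to the end of the word. *)
Lemma removable_asc w1 x w2 : (m <= size w1)%N -> (0 < size w1)%N ->
  path ltn (last 0%N (indices w1)) (x :: w2) -> ~ removable (indices w1 ++ x :: w2) (size w1).+1.
Proof.
move=> mw w10 pw [|[r [[mj jr rn] _ _]]]; first lia.
set s := indices w1 ++ x :: w2 in rn *.
have ss : size s = (size w1 + (size w2).+1)%N by rewrite /s size_cat size_map.
have nd k : (size w1 <= k)%N -> nth 0%N s k = nth 0%N (x :: w2) (k - size w1).
  by move=> kw; rewrite /s nth_cat size_map ltnNge kw.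
rewrite !nd; [|lia..].
have /= := sortedP 0%N (path_sorted pw) (r.-1 - size w1)%N.
have -> : (r.+1.-1 - size w1)%N = (r.-1 - size w1).+1 by lia.
move=> h; have /h : ((r.-1 - size w1).+1 < (size w2).+1)%N by lia.
move=> /=; lia.
Qed.

(* If no descent follows the unit, [unit_removable] fails and the moment is 0; by
   this lemma deleting the unit would give 0 too, so the case need not be
   distinguished in [unit_survives]. *)
Lemma phi_asc w1 w2 : (m <= size w1)%N -> w1 != [::] -> alternating_seq (indices w1) -> centered w1 ->
  path ltn (last 0%N (indices w1)) (indices w2) -> phi (wprod (w1 ++ w2)) = 0.
Proof.
elim: w2 w1 => [|[x q] w2 IH] w1 mw w0 aw kw pw.
  by rewrite cats0; exact: phi_centered.
have [/= xl pw2] := andP pw.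
have sw : (0 < size w1)%N by case: (w1) w0.
have arx : alternating_seq (rcons (indices w1) x).
  by rewrite alternating_rcons aw neq_ltn xl orbT.
have ax : alternating_seq (indices w1 ++ x :: indices w2).
  rewrite -cat_rcons; apply: alternating_rcons_cat => //.
    by apply: sub_sorted (path_sorted pw2) => a b /=; rewrite neq_ltn => ->.
  by case: (w2) pw2 => //= l w3 /andP[h _]; rewrite neq_ltn h orbT.
(* The unit part of the next letter vanishes; the centred part is appended to [w1], and the ascent
   goes on from [x]. *)
rewrite phi_center (phi_unit ax kw).2; last exact: removable_asc.
rewrite mulr0 addr0 -cat_rcons; apply: IH.
- by rewrite size_rcons; lia.
- by rewrite -size_eq0 size_rcons.
- by rewrite /indices map_rcons.
- by rewrite /centered all_rcons /= mean_center eqxx.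
- by rewrite /indices map_rcons last_rcons.
Qed.

(** Merging equal neighbours produces the alternating words that the axioms speak of. Head and
    emptiness are tracked because they decide whether the word may follow a given letter. *)
Lemma compress w : exists w',
  [/\ alternating_seq (indices w'), wprod w' = wprod w & head 0%N (indices w') = head 0%N (indices w) /\
  (w' == [::]) = (w == [::])].
Proof.
elim: w => [|[x p] w [w' [aw Ew [hw nw]]]]; first by exists [::].
case: w' aw Ew hw nw => [|[y q] w'] aw Ew hw nw.
  exists [:: (x, p)]; split => //=.
  by rewrite !wprod_cons Ew.
have [xy|xy] := eqVneq x y.
  exists ((x, p * q) :: w'); split => //=; first by rewrite xy.
  by rewrite !wprod_cons -Ew wprod_cons /= eval_letterM xy mulrA.
exists ((x, p) :: (y, q) :: w'); split => //=; first by rewrite /alternating_seq /= xy.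
by rewrite !(wprod_cons (x, p)) Ew.
Qed.

(** The part of [unit_removable] that sees only the letters up to the unit: [x] has position at most
    [m], or the indices from position [m] up to [x] ascend. Position [m] is the first one kept by
    [drop m.-1]. *)
Definition unit_survives (w : seq nat) x :=
  (size w < m)%N || sorted ltn (drop m.-1 (rcons w x)).

Hypothesis m_gt0 : (0 < m)%N.

(** Beyond level [m], removability also asks for a descent after the ascent. If none follows, both
    sides vanish by [phi_asc], so the criterion depends on [w1] and [x] alone. *)
Lemma phi_unit_rest w1 w2 x : alternating_seq (rcons (indices w1) x) -> centered w1 ->
  (w2 == [::]) || (head 0%N (indices w2) != x) ->
  phi (wprod (w1 ++ (x, 1) :: w2)) = (unit_survives (indices w1) x)%:R * phi (wprod (w1 ++ w2)).
Proof.
move=> ax kw hw2.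
have [w' [aw Ew [hw nw]]] := compress w2.
have -> : phi (wprod (w1 ++ (x, 1) :: w2)) = phi (wprod (w1 ++ (x, 1) :: w')).
  by rewrite !wprod_cat !wprod_cons Ew.
have -> : phi (wprod (w1 ++ w2)) = phi (wprod (w1 ++ w')) by rewrite !wprod_cat Ew.
rewrite -hw -nw in hw2; move: {w2 hw Ew nw} w' hw2 aw => w2 hw2 aw.
have aa : alternating_seq (indices w1 ++ x :: indices w2).
  by rewrite -cat_rcons; apply: alternating_rcons_cat => //; case: (w2) hw2.
have [hr hn] := phi_unit aa kw.
set s := indices w1 ++ x :: indices w2 in aa hr hn.
have ss : size s = (size w1 + (size w2).+1)%N by rewrite /s size_cat /= !size_map.
have srx : size (rcons (indices w1) x) = (size w1).+1 by rewrite size_rcons size_map.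
have nthr k : (k < (size w1).+1)%N -> nth 0%N s k = nth 0%N (rcons (indices w1) x) k.
  by move=> kw1; rewrite /s -cat_rcons nth_cat srx kw1.
case: (ltnP (size w1) m) => mw.
  by rewrite /unit_survives size_map mw mul1r; apply: hr; left.
rewrite /unit_survives size_map ltnNge mw /=.
have [so|so] := boolP (sorted _ _); last first.
  rewrite mul0r; apply: hn => -[|[r [[mj jr rn] _ asc _]]]; first lia.
  move/negP: so; apply; apply/(sortedP 0%N) => k.
  rewrite size_drop srx => ks; rewrite !nth_drop -!nthr; [|lia..].
  have := asc (m + k)%N; rewrite (_ : (m + k).-1 = (m.-1 + k)%N); last lia.
  rewrite (_ : (m + k).+1.-1 = (m.-1 + k.+1)%N); last lia.
  by apply; lia.
rewrite mul1r; case: (pselect (removable s (size w1).+1)) => [/hr //|nr].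
rewrite (hn nr); apply/esym; apply: phi_asc => //.
- by case: (w1) mw m_gt0 => //=; case: (m).
- by move: ax; rewrite alternating_rcons => /andP[].
have lx : (last 0%N (indices w1) < x)%N.
  have := sortedP 0%N so (size w1 - m)%N; rewrite size_drop srx => /(_ ltac:(lia)).
  rewrite !nth_drop !nth_rcons size_map.
  rewrite (_ : (m.-1 + (size w1 - m))%N = (size w1).-1); last lia.
  rewrite (_ : (m.-1 + (size w1 - m).+1)%N = size w1); last lia.
  rewrite -(nth_last 0%N (indices w1)) /indices size_map -/(indices w1).
  by rewrite ltnn eqxx ifT //; lia.
suff px : path ltn x (indices w2).
  by case: (w2) px => //= l w3 /andP[h1 h2]; rewrite (ltn_trans lx h1).
(* If the indices after [x] did not ascend to the end, the first failure would be a descent by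
   alternation, and would serve as [r]. *)
apply: contrapT => npx; apply: nr; right.
have [k kP] : exists k, (k < size w2)%N && ~~ (nth 0%N s (size w1 + k) < nth 0%N s (size w1 + k).+1)%N.
  apply: contrapT => nk; apply: npx; rewrite -/(sorted ltn (x :: indices w2)).
  apply/(sortedP 0%N) => k /= ks; rewrite size_map in ks.
  apply/negPn/negP => hk; apply: nk; exists k; rewrite -ltnS ks /=.
  apply: contra hk; rewrite /s -addnS !nth_cat !size_map !ifF; [|lia..].
  by rewrite !addKn.
have ek := ex_intro (fun k => (k < size w2)%N && ~~ (nth 0%N s (size w1 + k) < nth 0%N s (size w1 + k).+1)%N) k kP.
have [k0 /andP[k0s k0P] k0min] := ex_minnP ek.
(* Positions are counted from 1, list entries from 0. *)
exists (size w1 + k0).+1; split.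
- by split; lia.
- move=> l l1 lm; apply/eqP; have := sortedP 0%N aa l.-1.
  by case: l l1 lm => // l _ lm /=; apply; rewrite ss; lia.
- move=> l l1 lm lr; case: (ltnP l (size w1).+1) => lw.
    have := sortedP 0%N so (l - m)%N; rewrite size_drop srx => /(_ ltac:(lia)).
    rewrite !nth_drop -!nthr; [|lia..].
    rewrite (_ : (m.-1 + (l - m))%N = l.-1); last lia.
    by rewrite (_ : (m.-1 + (l - m).+1)%N = l); last lia.
  apply: contrapT => /negP hl; have := k0min (l.-1 - size w1)%N.
  rewrite (_ : (size w1 + (l.-1 - size w1))%N = l.-1); last lia.
  rewrite (_ : l.-1.+1 = l); last lia.
  by rewrite hl andbT => h; have := h ltac:(lia); lia.
- move=> /=; have := sortedP 0%N aa (size w1 + k0)%N; rewrite ss => h.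
  have /h : ((size w1 + k0).+1 < size w1 + (size w2).+1)%N by lia.
  by move: k0P; rewrite -leqNgt leq_eqVlt eq_sym => /orP[/eqP ->|//]; rewrite eqxx.
Qed.

(** If [w2] begins with the index [x], the unit is absorbed by that letter and the factor is 1. *)
Lemma phi_unit_any w1 w2 x : alternating_seq (rcons (indices w1) x) -> centered w1 ->
  exists b : bool, phi (wprod (w1 ++ (x, 1) :: w2)) = b%:R * phi (wprod (w1 ++ w2)).
Proof.
move=> ax kw; have [h|] := boolP ((w2 == [::]) || (head 0%N (indices w2) != x)).
  by exists (unit_survives (indices w1) x); exact: phi_unit_rest.
case: w2 => [|[y q] w2] //=; rewrite negbK => /eqP ->.
by exists true; rewrite mul1r wprod_merge mul1r.
Qed.

(** Induction on the total length, then on the unread part [rest]. A letter with the index of its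
    left neighbour is merged with it. Any other letter splits into a centred part, which joins [st],
    and a unit, which disappears up to a factor 0 or 1. The singleton has mean 0, so it is never
    lost, and at the end [phi_centered] applies. *)
Lemma phi_singleton st rest : alternating_seq (indices st) -> centered st ->
  (exists z r, [/\ (z, r) \in st ++ rest, mean r = 0 & count_mem z (indices (st ++ rest)) = 1%N]) ->
  phi (wprod (st ++ rest)) = 0.
Proof.
have [n] := ubnP (size st + size rest); elim: n st rest => // n IHn st rest.
elim: rest st => [|[x q] rest IH] st.
  rewrite cats0 => _ ast kst [z [r [zin _ _]]]; apply: phi_centered => //.
  by case: (st) zin.
move=> sz ast kst [z [r [zin r0 zc]]].
have [ax|] := boolP (alternating_seq (rcons (indices st) x)); last first.
  case/lastP: st ast kst sz zin zc => [|st [y p]] // ast kst sz zin zc.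
  rewrite alternating_rcons ast /= negb_or /indices map_rcons last_rcons /= negbK.
  move=> /andP[_ /eqP yx]; subst y; rewrite cat_rcons wprod_merge; apply: IHn.
  - by move: sz; rewrite size_rcons /=; lia.
  - by move: ast; rewrite /indices map_rcons alternating_rcons => /andP[].
  - by move: kst; rewrite /centered all_rcons => /andP[].
  (* The singleton [z] is not the merged index, since [x] occurs at least twice. *)
  have zx : z != x.
    apply/eqP => zx; move: zc; rewrite /indices cat_rcons map_cat count_cat /= zx eqxx; lia.
  exists z, r; split => //.
    move: zin; rewrite cat_rcons !mem_cat !inE !xpair_eqE (negbTE zx) /=.
    by [].
  by move: zc; rewrite /indices cat_rcons !map_cat !count_cat /= eq_sym (negbTE zx).
rewrite phi_center.
have -> : phi (wprod (st ++ (x, center q) :: rest)) = 0.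
  rewrite -cat_rcons; apply: IH.
  - by move: sz; rewrite size_rcons /=; lia.
  - by rewrite /indices map_rcons.
  - by rewrite /centered all_rcons /= mean_center eqxx.
  rewrite cat_rcons.
  have zc' : count_mem z (indices (st ++ (x, center q) :: rest)) = 1%N.
    by rewrite -zc /indices !map_cat.
  have [zx|zx] := eqVneq z x.
    exists x, (center q); split; first by rewrite mem_cat mem_head orbT.
      exact: mean_center.
    by move: zc'; rewrite zx.
  exists z, r; split => //.
  by move: zin; rewrite !mem_cat !inE !xpair_eqE (negbTE zx).
rewrite add0r; have [->|zq] := eqVneq (mean q) 0; first by rewrite mul0r.
have [b ->] := phi_unit_any rest ax kst.
rewrite (IHn st rest) ?mulr0 //; first by move: sz => /=; lia.
(* If [x] were [z], its only letter would carry [r], of mean 0, against [zq]. *)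
have zx : z != x.
  apply: contra_neq zq => zx; subst z.
  have : (x, r) \in st ++ rest -> False.
    move=> h; have : x \in indices st ++ indices rest.
      by rewrite -map_cat; apply/mapP; exists (x, r).
    rewrite -has_pred1 has_count count_cat.
    by move: zc; rewrite /indices map_cat count_cat /= eqxx; lia.
  move: zin; rewrite !mem_cat !inE => /or3P[h|/eqP [<-] //|h] [];
    by rewrite h ?orbT.
exists z, r; split => //.
  by move: zin; rewrite !mem_cat !inE !xpair_eqE (negbTE zx).
by move: zc; rewrite /indices !map_cat !count_cat /= eq_sym (negbTE zx).
Qed.

(** The recursion of [phi_singleton] with the polynomials fixed and the indices free. The
    coincidences among the indices only select a branch at each step, so adding the bounds of all
    branches gives a bound uniform in the indices. *)
Lemma phi_bounded (ps qs : seq {poly C}) : all (fun q => mean q == 0) ps ->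
  exists B : R, forall is_ js, size is_ = size ps -> size js = size qs -> alternating_seq is_ ->
    `|phi (wprod (zip is_ ps ++ zip js qs))| <= B%:C.
Proof.
have [n] := ubnP (size ps + size qs); elim: n ps qs => // n IHn ps qs.
elim: qs ps => [|q qs IH] ps sz kp.
  (* The empty word has moment 1; any other fully read word is centred and alternating, hence has
     moment 0. *)
  exists 1 => is_ [|//] si _ ai; rewrite cats0.
  have [->|w0] := eqVneq (zip is_ ps) [::]; first by rewrite wprod_nil Hphi.2 normr1.
  rewrite phi_centered ?normr0 ?ler01 //.
  - by rewrite /indices -/(unzip1 _) unzip1_zip ?si.
  - by rewrite /centered -(all_map snd (fun q => mean q == 0)) -/(unzip2 _) unzip2_zip ?si.
(* [B1] bounds the branch where the letter is centred and kept, [B2] the one where it becomes a unit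
   and is removed, [B3] the one where it is merged. *)
have [B1 HB1] : exists B : R, forall is_ js, size is_ = (size ps).+1 -> size js = size qs ->
    alternating_seq is_ -> `|phi (wprod (zip is_ (rcons ps (center q)) ++ zip js qs))| <= B%:C.
  have [||B HB] := IH (rcons ps (center q)).
  - by move: sz; rewrite size_rcons /=; lia.
  - by rewrite all_rcons mean_center eqxx.
  by exists B => is_ js si; apply: HB; rewrite size_rcons.
have [B2 HB2] := IHn ps qs ltac:(move: sz => /=; lia) kp.
have [B3 HB3] : exists B : R, forall is_ js x, size (rcons is_ x) = size ps -> size js = size qs ->
    alternating_seq is_ -> `|phi (wprod (zip (rcons is_ x) ps ++ (x, q) :: zip js qs))| <= B%:C.
  case/lastP: ps sz kp {HB1 HB2 IH} => [|ps p] sz kp.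
    by exists 0 => is_ js x; rewrite size_rcons.
  have [||B HB] := IHn ps ((p * q) :: qs).
  - by move: sz; rewrite size_rcons /=; lia.
  - by move: kp; rewrite all_rcons => /andP[].
  exists B => is_ js x; rewrite !size_rcons => -[si] sj ai.
  by rewrite zip_rcons // cat_rcons wprod_merge; apply: (HB is_ (x :: js)) => //=; rewrite sj.
(* The square root is the modulus of [mean q], written as a real number. *)
pose B4 := Num.sqrt ((complex.Re (mean q))^+2 + (complex.Im (mean q))^+2) * B2.
have posB B w : `|phi (wprod w)| <= B%:C -> 0 <= B.
  by move=> h; rewrite -lecR; apply: le_trans h; exact: normr_ge0.
exists (`|B1| + `|B4| + `|B3|) => is_ [//|x js] si [sj] ai /=.
have BB (a b : R) : a <= b -> a%:C <= b%:C by rewrite lecR.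
have [ax|] := boolP (alternating_seq (rcons is_ x)).
  rewrite phi_center; apply: le_trans (ler_normD _ _) _.
  have iz : indices (zip is_ ps) = is_ by rewrite /indices -/(unzip1 _) unzip1_zip ?si.
  have [||b ->] := @phi_unit_any (zip is_ ps) (zip js qs) x.
  - by rewrite iz.
  - by rewrite /centered -(all_map snd (fun q => mean q == 0)) -/(unzip2 _) unzip2_zip ?si.
  have h1 : `|phi (wprod (zip is_ ps ++ (x, center q) :: zip js qs))| <= `|B1|%:C.
    rewrite -cat_rcons -zip_rcons //; apply: le_trans (BB _ _ (ler_norm B1)).
    by apply: HB1 => //; rewrite size_rcons si.
  have h2 : `|mean q * (b%:R * phi (wprod (zip is_ ps ++ zip js qs)))| <= `|B4|%:C.
    apply: le_trans (BB _ _ (ler_norm B4)).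
    rewrite !normrM /B4 rmorphM /= -normc_def ler_wpM2l //.
    apply: le_trans (HB2 is_ js si sj ai).
    by case: b; rewrite ?normr1 ?mul1r // normr0 mul0r normr_ge0.
  apply: le_trans (lerD h1 h2) _; rewrite -rmorphD lecR; have := normr_ge0 B3; lra.
rewrite alternating_rcons ai /= negb_or negbK.
case/lastP: is_ si ai => [|is_ y] //= si ai; rewrite last_rcons => /andP[_ /eqP yx].
subst y; apply: le_trans (HB3 is_ js x si sj _) _.
  by move: ai; rewrite alternating_rcons => /andP[].
rewrite lecR; have := normr_ge0 B1; have := normr_ge0 B4; have := ler_norm B3; lra.
Qed.

(** * Moments of words in the standardised variables *)

Hypothesis HX1 : forall i, phi (X i) = 0.
Hypothesis HX2 : forall i, phi (X i ^+ 2) = 1.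

Definition word_moment (w : seq nat) : C := phi (\prod_(i <- w) X i).

Definition Xword (w : seq nat) : seq letter := [seq (i, 'X) | i <- w].

Lemma word_moment_Xword w : word_moment w = phi (wprod (Xword w)).
Proof.
by rewrite /word_moment /wprod /Xword big_map; congr phi; apply: eq_bigr => i _; rewrite /= eval_letterX.
Qed.

Lemma indices_Xword w : indices (Xword w) = w.
Proof. by rewrite /indices /Xword -map_comp map_id. Qed.

Lemma mean_X : mean 'X = 0.
Proof. by rewrite -(phi_eval_letter 0) eval_letterX. Qed.

Lemma mean_XX : mean ('X * 'X) = 1.
Proof. by rewrite -(phi_eval_letter 0) eval_letterM eval_letterX -expr2. Qed.

Lemma centered_Xword w : centered (Xword w).
Proof. by rewrite /centered /Xword all_map; apply/allP => i _ /=; rewrite mean_X. Qed.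

Lemma word_moment_singleton w z : count_mem z w = 1%N -> word_moment w = 0.
Proof.
move=> zc; rewrite word_moment_Xword -[Xword w]cat0s; apply: phi_singleton => //.
exists z, 'X; split; [|exact: mean_X|by rewrite cat0s indices_Xword].
by apply/mapP; exists z => //; rewrite -has_pred1 has_count zc.
Qed.

Lemma word_moment_bounded n : exists B : R, forall w, size w = n -> `|word_moment w| <= B%:C.
Proof.
have [//|B HB] := @phi_bounded [::] (nseq n 'X); exists B => w sw.
rewrite word_moment_Xword; have := HB [::] w erefl; rewrite size_nseq => /(_ sw isT) /=.
by rewrite (_ : zip _ _ = Xword w) //; elim: w n sw {HB} => [|i w IH] [|n] //= [/IH ->].
Qed.

Lemma word_moment_nil : word_moment [::] = 1.
Proof. by rewrite /word_moment big_nil Hphi.2. Qed.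

Lemma word_moment_alternating w : w != [::] -> alternating_seq w -> word_moment w = 0.
Proof.
move=> w0 aw; rewrite word_moment_Xword; apply: phi_centered; rewrite ?indices_Xword ?centered_Xword //.
by case: (w) w0.
Qed.

(** The centred part of the square is the only letter of index [x], so it contributes 0 by
    [phi_singleton]. The unit part has coefficient [phi (X x ^+ 2) = 1]. *)
Lemma word_moment_pair w1 w2 x : alternating_seq (rcons w1 x) -> x \notin w1 -> x \notin w2 ->
  word_moment (w1 ++ x :: x :: w2) = (unit_survives w1 x)%:R * word_moment (w1 ++ w2).
Proof.
move=> ax x1 x2; rewrite !word_moment_Xword /Xword !map_cat /= -!/(Xword _) wprod_merge phi_center mean_XX mul1r.
rewrite phi_singleton ?add0r ?indices_Xword ?centered_Xword //.
- rewrite phi_unit_rest ?indices_Xword ?centered_Xword //.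
  by case: (w2) x2 => //= y w3; rewrite inE negb_or eq_sym => /andP[].
- by move: ax; rewrite alternating_rcons => /andP[].
exists x, (center ('X * 'X)); split; [by rewrite mem_cat inE eqxx orbT|exact: mean_center|].
rewrite /indices map_cat /= -!/(indices _) !indices_Xword count_cat /= eqxx.
by move/count_memPn: x1 => ->; move/count_memPn: x2 => ->.
Qed.

End Words.

(** * Pair words and the stack automaton *)

Section PairWords.
Local Open Scope nat_scope.

Definition pairword (w : seq nat) := all (fun x => count_mem x w == 2) w.

(* In a pair word, [y] encloses [z] iff the subword on {y, z} is y z z y, and the
   two blocks cross iff it is y z y z or z y z y. *)
Definition filter2 (y z : nat) (w : seq nat) := [seq l <- w | (l == y) || (l == z)].

Definition word_inner (w : seq nat) y z := filter2 y z w == [:: y; z; z; y].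

Definition word_noncrossing (w : seq nat) :=
  all (fun y => all (fun z => filter2 y z w != [:: y; z; y; z]) w) w.

Definition word_depth (w : seq nat) y := (count (fun y' => word_inner w y' y) (undup w)).+1.

Definition word_ordered m (w : seq nat) :=
  all (fun y => all (fun z => (m <= word_depth w y) && word_inner w y z ==> (y < z)) w) w.

(* The stack [st] is stored with its top first. *)
Fixpoint stack_run m (st w : seq nat) : bool :=
  if w is x :: w' then
    if st is y :: st' then
      if x == y then sorted ltn (drop m.-1 (rcons (rev st') x)) && stack_run m st' w'
      else stack_run m (x :: st) w'
    else stack_run m [:: x] w'
  else nilp st.

Lemma filter2_cat y z w1 w2 : filter2 y z (w1 ++ w2) = filter2 y z w1 ++ filter2 y z w2.
Proof. exact: filter_cat. Qed.

Lemma filter2_sym y z w : filter2 y z w = filter2 z y w.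
Proof. by apply: eq_filter => l; rewrite orbC. Qed.

Lemma filter2_notin y z w : y \notin w -> filter2 y z w = nseq (count_mem z w) z.
Proof.
elim: w => //= l w IH; rewrite inE negb_or eq_sym => /andP[/negbTE -> /IH ->] /=.
by case: eqP => [->|].
Qed.

Lemma filter2_notin2 y z w : y \notin w -> z \notin w -> filter2 y z w = [::].
Proof. by move=> yw /count_memPn zw; rewrite filter2_notin // zw. Qed.

Lemma filter2_id y w : filter2 y y w = nseq (count_mem y w) y.
Proof. by elim: w => //= l w ->; rewrite orbb; case: eqP => [->|]. Qed.

Lemma size_filter2 y z w : y != z -> size (filter2 y z w) = count_mem y w + count_mem z w.
Proof.
move=> yz; rewrite size_filter -[LHS]addn0 -count_predUI; congr (_ + _).
apply/esym/eqP; rewrite -leqn0 leqNgt -has_count; apply/hasPn => l _ /=.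
by apply/negP => /andP[/eqP -> ]; apply/negP.
Qed.

Lemma count_filter2 y z l w : (l == y) || (l == z) -> count_mem l (filter2 y z w) = count_mem l w.
Proof.
move=> h; rewrite count_filter; apply: eq_count => k /=.
by case: eqP => // ->; rewrite h.
Qed.

Lemma filter2_once y z w : y != z -> count_mem y w = 1 -> count_mem z w = 1 ->
  filter2 y z w = [:: y; z] \/ filter2 y z w = [:: z; y].
Proof.
move=> yz cy cz; have := size_filter2 w yz.
have := @count_filter2 y z y w; have := @count_filter2 y z z w.
rewrite cy cz !eqxx orbT => /(_ isT) + /(_ isT).
have : all (fun l => (l == y) || (l == z)) (filter2 y z w) by exact: filter_all.
case: (filter2 y z w) => [|a [|b [|c f]]] //= /and3P[].
have := yz; rewrite eq_sym => /negbTE zy.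
move=> /orP[] /eqP -> /orP[] /eqP ->; rewrite ?eqxx ?zy ?(negbTE yz) //; by auto.
Qed.

Lemma pairword_count w x : pairword w -> x \in w -> count_mem x w = 2.
Proof. by move=> /allP h /h /eqP. Qed.

(** If [x] were pushed a second time, the letter [z] just above the first [x] would have its partner
    in [w], giving the crossing [x z x z]. *)
Lemma uniq_stack s w : pairword (s ++ w) -> word_noncrossing (s ++ w) -> alternating_seq s -> uniq s.
Proof.
elim/last_ind: s w => [|s x IH] w // pw nw.
rewrite alternating_rcons => /andP[as_ sx].
have us : uniq s by apply: (IH (x :: w)) => //; rewrite -cat_rcons.
rewrite rcons_uniq us andbT; apply/negP => xs.
move: pw nw us sx {IH as_}; case/splitPr: xs => a b.
(* Such a [z] exists because [x] is pushed onto a different letter. *)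
case: b => [|z b] pw nw us; first by rewrite last_cat /= eqxx orbF; case: (a).
move=> _; move: us; rewrite cat_uniq /= !inE !negb_or.
move=> /and3P[_ /and3P[xa za _] /and3P[/andP[xz xb] zb _]].
have Xword : x \notin w.
  have := pairword_count (x := x) pw; rewrite !mem_cat mem_rcons inE eqxx => /(_ isT).
  rewrite !count_cat -cats1 !count_cat /= !eqxx /= => h; apply/count_memPn => /=; lia.
have zw : count_mem z w = 1.
  have := pairword_count (x := z) pw.
  rewrite mem_cat mem_rcons inE mem_cat !inE eqxx !orbT => /(_ isT).
  rewrite !count_cat -cats1 !count_cat /= !eqxx (negbTE xz).
  by move/count_memPn: za => ->; move/count_memPn: zb => -> /=; lia.
move/allP: nw => /(_ x); rewrite !mem_cat mem_rcons inE eqxx => /(_ isT).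
move=> /allP /(_ z); rewrite mem_cat mem_rcons inE mem_cat !inE eqxx !orbT => /(_ isT).
move/negP; apply; rewrite filter2_cat -cats1 !filter2_cat /= (filter2_notin _ Xword) zw.
rewrite (filter2_notin2 xa za) /filter2 /= !eqxx /= orbT /= -/(filter2 x z b) (filter2_notin2 xb zb).
by [].
Qed.

(** * Deleting an adjacent pair *)

Section RemovePair.
Variables (s w : seq nat) (x : nat).
Hypothesis xs : x \notin s.
Hypothesis Xword : x \notin w.
Local Notation W := (s ++ x :: x :: w).
Local Notation V := (s ++ w).

Lemma filter2_rem y z : y != x -> z != x -> filter2 y z W = filter2 y z V.
Proof.
move=> yx zx; rewrite !filter2_cat /=; congr (_ ++ _); rewrite /filter2 /=.
by rewrite !(eq_sym x) (negbTE yx) (negbTE zx).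
Qed.

Lemma filter2_remx z : z != x ->
  filter2 x z W = nseq (count_mem z s) z ++ [:: x; x] ++ nseq (count_mem z w) z.
Proof.
move=> zx; rewrite filter2_cat (filter2_notin _ xs); congr (_ ++ _).
by rewrite -(filter2_notin _ Xword) /filter2 /= eqxx.
Qed.

Lemma filter2_remxx : filter2 x x W = [:: x; x].
Proof.
by rewrite filter2_id count_cat /= eqxx; move/count_memPn: xs => ->; move/count_memPn: Xword => ->.
Qed.

Lemma mem_W y : (y \in W) = (y == x) || (y \in V).
Proof. by rewrite !mem_cat !inE; case: (y == x); rewrite ?orbT. Qed.

Lemma mem_V_neq y : y \in V -> y != x.
Proof. by apply: contraL => /eqP ->; rewrite mem_cat negb_or xs. Qed.

Lemma pairword_rem : pairword W -> pairword V.
Proof.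
move=> pw; apply/allP => y yV; have yx := mem_V_neq yV.
have := pairword_count (x := y) pw; rewrite mem_W yV orbT => /(_ isT).
by rewrite !count_cat /= !(eq_sym x) (negbTE yx) => /= ->.
Qed.

(** The two occurrences of [x] are adjacent in every two-letter subword, so [x] takes part in no
    crossing. *)
Lemma word_noncrossing_rem : word_noncrossing W = word_noncrossing V.
Proof.
apply/allP/allP => h y yV.
  have yx := mem_V_neq yV; apply/allP => z zV; have zx := mem_V_neq zV.
  have := h y; rewrite mem_W yV orbT => /(_ isT) /allP /(_ z).
  by rewrite mem_W zV orbT filter2_rem // => /(_ isT).
apply/allP => z zV; move: yV zV; rewrite !mem_W.
have [->|yx] /= := eqVneq y x; have [->|zx] /= := eqVneq z x => yV zV.
- by rewrite filter2_remxx; apply/eqP => /(congr1 size).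
- rewrite filter2_remx //; case: (count_mem z s) => [|i] /=.
    by rewrite !eqseq_cons (eq_sym x) (negbTE zx) andbF.
  by rewrite !eqseq_cons (negbTE zx).
- rewrite filter2_sym filter2_remx //; case: (count_mem y s) => [|[|i]] /=.
  + by rewrite !eqseq_cons (eq_sym x) (negbTE yx).
  + by rewrite !eqseq_cons (eq_sym x) (negbTE yx) !andbF.
  + by rewrite !eqseq_cons (negbTE yx) !andbF.
by rewrite filter2_rem //; apply: (allP (h y yV)).
Qed.

Lemma word_inner_reml z : word_inner W x z = false.
Proof.
rewrite /word_inner; have [->|zx] := eqVneq z x; first by
  rewrite filter2_remxx; apply/negbTE/eqP => /(congr1 size).
rewrite filter2_remx //; case: (count_mem z s) => [|i] /=.
  by rewrite !eqseq_cons (eq_sym x) (negbTE zx) andbF.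
by rewrite !eqseq_cons (negbTE zx).
Qed.

Lemma word_inner_remr y : y != x -> word_inner W y x = (count_mem y s == 1) && (count_mem y w == 1).
Proof.
move=> yx; rewrite /word_inner filter2_sym filter2_remx //; case: (count_mem y s) => [|[|i]] /=.
- by rewrite !eqseq_cons (eq_sym x) (negbTE yx).
- rewrite !eqseq_cons !eqxx /=; case: (count_mem y w) => [|[|j]] //=.
    by rewrite eqseq_cons !eqxx.
  by rewrite eqseq_cons andbF.
by rewrite !eqseq_cons (negbTE yx) !andbF.
Qed.

Lemma word_depth_rem y : y != x -> word_depth W y = word_depth V y.
Proof.
move=> yx; congr _.+1.
have /permP -> : perm_eq (undup W) (x :: undup V).
  apply: uniq_perm; rewrite ?undup_uniq //=.
    by rewrite undup_uniq andbT mem_undup; apply: contraL (eqxx x) => /mem_V_neq.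
  by move=> z; rewrite inE !mem_undup mem_W.
rewrite /= word_inner_reml add0n; apply: eq_in_count => z; rewrite mem_undup => /mem_V_neq zx.
by rewrite /word_inner filter2_rem.
Qed.

(** An adjacent pair encloses no block. Hence it changes no other depth, and the only new conditions
    have [x] as the inner block. *)
Lemma word_ordered_rem m : word_ordered m W =
  word_ordered m V && all (fun y => (m <= word_depth V y) && word_inner W y x ==> (y < x)) V.
Proof.
apply/allP/andP => [h|[/allP h1 /allP h2] y].
  split; apply/allP => y yV; have yx := mem_V_neq yV;
    have := h y; rewrite mem_W yV orbT => /(_ isT) /allP h'.
    apply/allP => z zV; have zx := mem_V_neq zV.
    by have := h' z; rewrite mem_W zV orbT /word_inner filter2_rem // word_depth_rem //; apply.
  by have := h' x; rewrite mem_W eqxx word_depth_rem //; apply.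
rewrite mem_W => /orP[/eqP -> |yV]; apply/allP => z.
  by rewrite word_inner_reml andbF.
have yx := mem_V_neq yV.
rewrite mem_W word_depth_rem // => /orP[/eqP ->|zV]; first exact: h2.
by rewrite /word_inner filter2_rem ?(mem_V_neq zV) //; apply: (allP (h1 y yV)).
Qed.

End RemovePair.

(** Every letter of [s] opens a block that closes in [w]. Without crossings the later of two open
    blocks closes first, so open blocks are nested in the order of the stack. *)
Lemma word_inner_stack s w y y' : pairword (s ++ w) -> word_noncrossing (s ++ w) -> uniq s ->
  y \in s -> word_inner (s ++ w) y' y = (y' \in take (index y s) s).
Proof.
move=> pw nw us ys.
have cw z : z \in s -> count_mem z w = 1.
  move=> zs; have := pairword_count (x := z) pw; rewrite mem_cat zs => /(_ isT).
  by rewrite count_cat count_uniq_mem // zs => -[].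
case/splitPr: ys us pw nw cw => a b us pw nw cw.
have [ya yb] : y \notin a /\ y \notin b.
  by move: us; rewrite cat_uniq /= => /and4P[_ /norP[? _] ? _].
rewrite index_cat (negbTE ya) /= eqxx addn0 take_size_cat //.
have [y'a|y'a] := boolP (y' \in a).
  have [y'y y'b] : y' != y /\ y' \notin b.
    move: us; rewrite cat_uniq /= => /and3P[_ /norP[_ /hasPn h] _].
    split; first by apply: contraNneq ya => <-.
    by apply/negP => /h; rewrite /= y'a.
  have ca : count_mem y' a = 1.
    by rewrite count_uniq_mem ?y'a //; move: us; rewrite cat_uniq => /andP[].
  have fa : filter2 y' y (a ++ y :: b) = [:: y'; y].
    rewrite filter2_cat [filter2 _ _ a]filter2_sym (filter2_notin _ ya) ca /=.
    by rewrite /filter2 /= eqxx orbT -/(filter2 _ _ _) (filter2_notin2 y'b yb).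
  rewrite /word_inner filter2_cat fa.
  have c1 : count_mem y' w = 1 by apply: cw; rewrite mem_cat y'a.
  have c2 : count_mem y w = 1 by apply: cw; rewrite mem_cat inE eqxx orbT.
  case: (filter2_once y'y c1 c2) => fw; rewrite fw ?eqxx //.
  have h1 : y' \in (a ++ y :: b) ++ w by rewrite !mem_cat y'a.
  have h2 : y \in (a ++ y :: b) ++ w by rewrite !mem_cat inE eqxx orbT.
  by move: (allP (allP nw _ h1) _ h2); rewrite filter2_cat fa fw eqxx.
rewrite /word_inner -catA filter2_cat (filter2_notin2 y'a ya) /= /filter2 /= eqxx orbT /=.
have [->|yy'] := eqVneq y' y; last by rewrite eqseq_cons eq_sym (negbTE yy').
rewrite -/(filter2 _ _ _) filter2_id.
have := cw y; rewrite mem_cat inE eqxx orbT count_cat => /(_ isT) ->.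
by move/count_memPn: yb => ->; apply/negbTE/eqP => /(congr1 size).
Qed.

(** The blocks enclosing an open block are those below it, so depth is the height in the stack. *)
Lemma word_depth_stack s w y : pairword (s ++ w) -> word_noncrossing (s ++ w) -> uniq s ->
  y \in s -> word_depth (s ++ w) y = (index y s).+1.
Proof.
move=> pw nw us ys; congr _.+1.
rewrite (eq_count (a2 := mem (take (index y s) s))); last first.
  by move=> z; rewrite word_inner_stack.
have st : size (take (index y s) s) = index y s.
  by rewrite size_take index_mem ys.
rewrite -{2}st -size_filter; apply: perm_size; apply: uniq_perm.
- by rewrite filter_uniq // undup_uniq.
- exact: take_uniq.
move=> z; rewrite mem_filter mem_undup mem_cat /=; case: (boolP (z \in take _ _)) => //= zt.
by rewrite (mem_take zt).
Qed.

Lemma mem_drop_uniq (T : eqType) k (s : seq T) y : uniq s -> y \in s ->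
  (y \in drop k s) = (k <= index y s).
Proof.
elim: s k => [|x s IH] k; first by rewrite in_nil.
case: k => [|k] /andP[xs us]; first by rewrite drop0 leq0n => ->.
rewrite inE /= eq_sym; have [<-|xy] /= := eqVneq; last exact: IH.
by move=> _; apply: contraNF xs; exact: mem_drop.
Qed.

(** A push does not change the word, and a pop deletes an adjacent pair. By [word_ordered_rem] the
    pop must check [y < x] for the stack letters [y] of depth at least [m]; the sortedness test also
    compares these letters with each other, which the remaining word already guarantees. *)
Lemma stack_runE m st w : 0 < m -> pairword (rev st ++ w) -> alternating_seq (rev st) ->
  stack_run m st w = word_noncrossing (rev st ++ w) && word_ordered m (rev st ++ w).
Proof.
move=> m0; elim: w st => [|x w IH] st pw ast.
  (* A nonempty stack at the end would hold a letter without partner. *)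
  rewrite cats0 in pw *; case: st pw ast => [|y st] // pw ast.
  apply/esym; apply: contraTF pw => /andP[nw _].
  rewrite -[rev _]cats0 in nw *; apply/negP => pw.
  have us := uniq_stack pw nw ast; rewrite cats0 in pw.
  have yin : y \in rev (y :: st) by rewrite mem_rev mem_head.
  by have := pairword_count pw yin; rewrite count_uniq_mem // yin.
case: st pw ast => [|y st] pw ast /=.
  by rewrite IH.
have [xy|xy] := eqVneq x y; last first.
  rewrite IH; rewrite ?[rev (x :: _)]rev_cons ?cat_rcons //.
  by rewrite alternating_rcons ast rev_cons last_rcons (eq_sym y) xy orbT.
subst y; move: pw ast; rewrite rev_cons cat_rcons; set s := rev st => pw asx.
have as_ : alternating_seq s by move: asx; rewrite alternating_rcons => /andP[].
have [xs Xword] : x \notin s /\ x \notin w.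
  have := pairword_count (x := x) pw; rewrite mem_cat mem_head orbT => /(_ isT).
  rewrite count_cat /= eqxx /= => h; split; apply/count_memPn => /=; lia.
have pV := pairword_rem xs Xword pw.
rewrite IH // word_noncrossing_rem // word_ordered_rem // andbCA andbA [in RHS]andbA.
have [nV|] //= := boolP (word_noncrossing (s ++ w)); rewrite ?andbF //.
have [oV|] //= := boolP (word_ordered m (s ++ w)); rewrite ?andbF // andbT.
have us := uniq_stack pV nV as_.
(* The blocks around [x] are the open ones, and depth at least [m] means index at least [m.-1] in
   [s]. *)
have cond y : y \in s ++ w -> (m <= word_depth (s ++ w) y) && word_inner (s ++ x :: x :: w) y x
    = (y \in drop m.-1 s).
  move=> yV; have yx := mem_V_neq xs Xword yV; rewrite word_inner_remr // count_uniq_mem //.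
  have [ys|ys] := boolP (y \in s); last first.
    by rewrite andbF; apply/esym/negbTE; apply: contra ys; exact: mem_drop.
  have -> : count_mem y w = 1.
    by have := pairword_count pV yV; rewrite count_cat count_uniq_mem // ys => -[].
  rewrite word_depth_stack // !andbT.
  by rewrite mem_drop_uniq //; case: (m) m0.
rewrite (eq_in_all (a2 := fun y => (y \in drop m.-1 s) ==> (y < x))); last first.
  by move=> y yV; rewrite cond.
have -> : all (fun y => (y \in drop m.-1 s) ==> (y < x)) (s ++ w) = all (ltn^~ x) (drop m.-1 s).
  apply/allP/allP => h y yi; last by apply/implyP => /h.
  by have := h y; rewrite mem_cat (mem_drop yi) => /(_ isT) /implyP; apply.
case: (leqP m.-1 (size s)) => ms; last first.
  by rewrite !drop_oversize // ?size_rcons // ltnW.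
rewrite drop_rcons // sorted_pairwise; last exact: ltn_trans.
rewrite pairwise_rcons; case: (all _ _) => //=.
(* The letters kept on the stack are nested and of depth at least [m], so [oV] orders them. *)
apply/(pairwiseP 0) => i j; rewrite !inE /= size_drop !ltn_subRL => hi hj ij; rewrite !nth_drop.
set y := nth 0 s _; set z := nth 0 s _.
have ys : y \in s by exact: mem_nth.
have zs : z \in s by exact: mem_nth.
have yV : y \in s ++ w by rewrite mem_cat ys.
have zV : z \in s ++ w by rewrite mem_cat zs.
have := allP (allP oV y yV) z zV.
rewrite word_depth_stack // word_inner_stack // !index_uniq //.
move/implyP; apply; apply/andP; split; first by case: (m) m0 => // k _; rewrite ltnS leq_addr.
rewrite /y -(nth_take (n0 := m.-1 + j)) ?ltn_add2l //.
by rewrite mem_nth // size_take_min leq_min hi ltn_add2l ij.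
Qed.

End PairWords.

(** * Words as ordered partitions *)

(** Three facts about moments match the outcomes of [stack_run]: an empty stack at the end, a
    nonempty one, and a pop. A push leaves the word unchanged. *)
Lemma word_moment_stack (V : nzRingType) (m : nat) (word_moment : seq nat -> V) :
  word_moment [::] = 1 -> (forall w, w != [::] -> alternating_seq w -> word_moment w = 0) ->
  (forall w1 w2 x, alternating_seq (rcons w1 x) -> x \notin w1 -> x \notin w2 ->
    word_moment (w1 ++ x :: x :: w2) = (sorted ltn (drop m.-1 (rcons w1 x)))%:R * word_moment (w1 ++ w2)) ->
  forall st w, pairword (rev st ++ w) -> alternating_seq (rev st) ->
    word_moment (rev st ++ w) = (stack_run m st w)%:R.
Proof.
move=> mom0 moma momp st w; elim: w st => [|x w IH] st pw ast.
  rewrite cats0; case: st {pw} ast => [|y st] ast /=; first exact: mom0.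
  by apply: moma => //; rewrite rev_cons -size_eq0 size_rcons.
case: st pw ast => [|y st] pw ast /=; first exact: (IH [:: x]).
have [xy|xy] := eqVneq x y; last first.
  rewrite -IH; rewrite ?[rev (x :: _)]rev_cons ?cat_rcons //.
  by rewrite alternating_rcons ast rev_cons last_rcons (eq_sym y) xy orbT.
subst y; move: pw ast; rewrite rev_cons cat_rcons => pw asx.
have [xs Xword] : x \notin rev st /\ x \notin w.
  have := pairword_count (x := x) pw; rewrite mem_cat mem_head orbT => /(_ isT).
  rewrite count_cat /= eqxx /= => h; split; apply/count_memPn => /=; lia.
rewrite momp // IH; last by move: asx; rewrite alternating_rcons => /andP[].
  by rewrite -natrM mulnb.
exact: pairword_rem pw.
Qed.

(** * Pair colourings seen through the patterns of two blocks *)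

Section Colouring.
Local Open Scope nat_scope.
Variables (n k : nat) (c : {ffun 'I_n -> 'I_k}).

Definition colour_positions (y z : 'I_k) := [seq x <- enum 'I_n | (c x == y) || (c x == z)].
(** The counterpart of [filter2] for colourings. *)
Definition colour_filter (y z : 'I_k) := [seq c x | x <- colour_positions y z].

Lemma mem_colour_positions y z x : (x \in colour_positions y z) = (c x == y) || (c x == z).
Proof. by rewrite mem_filter mem_enum andbT. Qed.

Lemma sorted_enum_ord : sorted (fun a b : 'I_n => a < b) (enum 'I_n).
Proof. by have := iota_ltn_sorted 0 n; rewrite -val_enum_ord sorted_map. Qed.

Lemma sorted_colour_positions y z : sorted (fun a b : 'I_n => a < b) (colour_positions y z).
Proof. by apply: sorted_filter sorted_enum_ord => a b d; apply: ltn_trans. Qed.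

Lemma colour_positionsE y z (s : seq 'I_n) : sorted (fun a b : 'I_n => a < b) s ->
  (forall x, (x \in s) = (c x == y) || (c x == z)) -> colour_positions y z = s.
Proof.
move=> ss ms; apply: (irr_sorted_eq (leT := fun a b : 'I_n => a < b)) => //.
- by move=> a b d; apply: ltn_trans.
- by move=> a; rewrite ltnn.
- exact: sorted_colour_positions.
by move=> x; rewrite mem_colour_positions ms.
Qed.

Hypothesis cP : pair_part c.

Lemma card_colour r : #|[set x | c x == r]| = 2.
Proof. by move/forallP: cP => /(_ r) /eqP. Qed.

Lemma count_colour r : count_mem r (codom c) = 2.
Proof.
rewrite -(card_colour r) cardsE cardE /codom count_map size_filter enumT.
by apply: eq_count.
Qed.

Lemma colour_filter_id y : colour_filter y y = [:: y; y].
Proof.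
have := count_colour y; rewrite /codom count_map => h.
rewrite /colour_filter /colour_positions.
have /all_pred1P -> : all (pred1 y) [seq c x | x <- enum 'I_n & (c x == y) || (c x == y)].
  by apply/allP => _ /mapP[x + ->]; rewrite mem_filter orbb => /andP[].
rewrite size_map size_filter (eq_count (a2 := preim c (pred1 y))) ?h //.
by move=> x /=; rewrite orbb.
Qed.

Lemma colour_pair a b x : a != b -> c a = c b -> c x = c a -> (x == a) || (x == b).
Proof.
move=> ab cab cx; have : [set a; b] = [set x | c x == c a].
  apply/eqP; rewrite eqEcard card_colour cards2 ab leqnn andbT.
  by apply/fintype.subsetP => z; rewrite !inE => /orP[] /eqP -> //; rewrite cab.
by move/setP/(_ x); rewrite !inE cx eqxx.
Qed.

(** With blocks of two points, a crossing quadruple exhausts both blocks and is therefore their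
    whole pattern. *)
Lemma noncrossingE : noncrossing c = [forall y, forall z, colour_filter y z != [:: y; z; y; z]].
Proof.
apply/idP/forallP => [nc y|h].
  apply/forallP => z; apply/eqP => F.
  have [yz|yz] := eqVneq y z; first by move: F; rewrite yz colour_filter_id.
  have := sorted_colour_positions y z; move: F; rewrite /colour_filter.
  case: (colour_positions y z) => [|a [|b [|d [|e [|? ?]]]]] //= [ca cb cd ce] /and4P[ab bd de _].
  move: nc => /forallP/(_ a)/forallP/(_ b)/forallP/(_ d)/forallP/(_ e).
  by rewrite ab bd de ca cb cd ce !eqxx (negbTE yz).
apply/forallP => s; apply/forallP => r; apply/forallP => s'; apply/forallP => r'.
apply/implyP => /and5P[sr rs' s'r' /eqP cs /eqP cr]; apply/negPn/negP => csr.
move: (h (c s)) => /forallP /(_ (c r)) /eqP; apply.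
have ss' : s != s' by rewrite -(inj_eq val_inj) /= neq_ltn (ltn_trans sr rs').
have rr' : r != r' by rewrite -(inj_eq val_inj) /= neq_ltn (ltn_trans rs' s'r').
rewrite /colour_filter (@colour_positionsE _ _ [:: s; r; s'; r']) /= ?sr ?rs' ?s'r' -?cs -?cr //.
move=> x; rewrite !inE; apply/idP/idP.
  by move=> /or4P[] /eqP ->; rewrite -?cs -?cr eqxx ?orbT.
move=> /orP[] /eqP cx.
  by case/orP: (colour_pair ss' cs cx) => ->; rewrite ?orbT.
by case/orP: (colour_pair rr' cr cx) => ->; rewrite ?orbT.
Qed.

(** Again four points exhaust two distinct blocks; for [j = i] both sides are false. *)
Lemma innerE j i : inner c j i = (colour_filter j i == [:: j; i; i; j]).
Proof.
have [ji|ji] := eqVneq j i.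
  subst i; rewrite colour_filter_id; apply/idP/idP; last by rewrite /eq_op /= !andbF.
  move=> /existsP[p /existsP[q /and5P[pq /eqP cp cq _ /forallP /(_ p)]]].
  by rewrite cp eqxx ltnn.
apply/idP/eqP => [|F].
  move=> /existsP[p /existsP[q /and5P[pq /eqP cp /eqP cq _ /forallP hs]]].
  have /cards2P [a [b [ab abE]]] : #|[set x | c x == i]| == 2 by rewrite card_colour.
  have [s1 [s2 [s12 cs1 cs2]]] : exists s1 s2 : 'I_n, [/\ s1 < s2, c s1 = i & c s2 = i].
    move/setP: abE => abE; have := abE a; have := abE b.
    rewrite !inE !eqxx orbT => /eqP cb /eqP ca.
    case: (ltngtP a b) => h; [by exists a, b|by exists b, a|].
    by move/val_inj: h ab => ->; rewrite eqxx.
  have /andP[ps1 s1q] : (p < s1) && (s1 < q) by have := hs s1; rewrite cs1 eqxx.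
  have /andP[ps2 s2q] : (p < s2) && (s2 < q) by have := hs s2; rewrite cs2 eqxx.
  rewrite /colour_filter (@colour_positionsE _ _ [:: p; s1; s2; q]) /= ?ps1 ?s12 ?s2q ?cp ?cq ?cs1 ?cs2 //.
  move=> x; rewrite !inE; apply/idP/idP.
    by move=> /or4P[] /eqP ->; rewrite ?cp ?cq ?cs1 ?cs2 eqxx ?orbT.
  have pq' : p != q by rewrite -(inj_eq val_inj) /= neq_ltn pq.
  have s12' : s1 != s2 by rewrite -(inj_eq val_inj) /= neq_ltn s12.
  move=> /orP[] /eqP cx.
    have cpq : c p = c q by rewrite cp cq.
    by rewrite -cp in cx; case/orP: (colour_pair pq' cpq cx) => ->; rewrite ?orbT.
  have cs12 : c s1 = c s2 by rewrite cs1 cs2.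
  by rewrite -cs1 in cx; case/orP: (colour_pair s12' cs12 cx) => ->; rewrite ?orbT.
have := sorted_colour_positions j i; have mP := mem_colour_positions j i; move: F mP; rewrite /colour_filter.
case: (colour_positions j i) => [|p [|s1 [|s2 [|q [|? ?]]]]] //= [cp cs1 cs2 cq] mP.
move=> /and4P[ps1 s12 s2q _]; have pq := ltn_trans ps1 (ltn_trans s12 s2q).
apply/existsP; exists p; apply/existsP; exists q; rewrite pq cp cq !eqxx /=.
apply/andP; split; apply/forallP => x; apply/implyP.
  move=> /andP[px xq]; apply/eqP => cx; have := mP x; rewrite cx eqxx !inE => /or4P[] /eqP xE.
  - by move: px; rewrite xE ltnn.
  - by move: ji; rewrite -cx xE cs1 eqxx.
  - by move: ji; rewrite -cx xE cs2 eqxx.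
  - by move: xq; rewrite xE ltnn.
move=> /eqP cx; have := mP x; rewrite cx eqxx orbT !inE => /or4P[] /eqP xE.
- by move: ji; rewrite -cx xE cp eqxx.
- by rewrite xE ps1 (ltn_trans s12 s2q).
- by rewrite xE s2q (ltn_trans ps1 s12).
- by move: ji; rewrite -cx xE cq eqxx.
Qed.

End Colouring.

(** * Words obtained from a colouring by an increasing labelling of its blocks *)

Section ColourWord.
Local Open Scope nat_scope.
Variables (n k : nat) (c : {ffun 'I_n -> 'I_k}) (v : 'I_k -> nat).
Hypothesis vinc : forall r r' : 'I_k, r < r' -> v r < v r'.

Definition colour_word := [seq v (c x) | x <- enum 'I_n].

Lemma v_ltn r r' : (v r < v r') = (r < r').
Proof.
case: (ltngtP r r') => h; first by rewrite vinc.
  by apply/negbTE; rewrite -leqNgt ltnW ?vinc.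
by rewrite (val_inj h) ltnn.
Qed.

Lemma v_inj : injective v.
Proof.
move=> r r' h; apply: val_inj; case: (ltngtP r r') => // /vinc; by rewrite h ltnn.
Qed.

Lemma colour_wordE : colour_word = [seq v r | r <- codom c].
Proof. by rewrite /colour_word /codom /image_mem -map_comp. Qed.

Lemma count_colour_word r : count_mem (v r) colour_word = #|[set x | c x == r]|.
Proof.
rewrite colour_wordE /codom -map_comp count_map cardsE cardE size_filter enumT.
by apply: eq_count => x; rewrite /= (inj_eq v_inj).
Qed.

Lemma mem_colour_word r : ordpart c -> v r \in colour_word.
Proof.
move=> /forallP /(_ r) /existsP[x /eqP <-]; apply/mapP; exists x => //.
by rewrite mem_enum.
Qed.

Lemma colour_word_mem y : y \in colour_word -> exists r, y = v r.
Proof. by move=> /mapP[x _ ->]; exists (c x). Qed.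

Lemma filter2_colour_word y z : filter2 (v y) (v z) colour_word = [seq v r | r <- colour_filter c y z].
Proof.
rewrite /filter2 /colour_word filter_map /colour_filter /colour_positions -map_comp; congr map.
by apply: eq_filter => x; rewrite /= !(inj_eq v_inj).
Qed.

Hypothesis cs : ordpart c.

Lemma pairword_colour_word : pairword colour_word = pair_part c.
Proof.
apply/allP/forallP => [h r|h _ /colour_word_mem[r ->]]; last by rewrite count_colour_word.
by rewrite -count_colour_word; apply: h; exact: mem_colour_word.
Qed.

Hypothesis cP : pair_part c.

Lemma word_inner_colour_word y z : word_inner colour_word (v y) (v z) = inner c y z.
Proof.
by rewrite innerE // /word_inner filter2_colour_word -[[:: v y; _; _; _]]/(map v [:: y; z; z; y])
  (inj_eq (inj_map v_inj)).
Qed.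

Lemma word_noncrossing_colour_word : word_noncrossing colour_word = noncrossing c.
Proof.
rewrite noncrossingE //; apply/allP/forallP => [h y|h _ /colour_word_mem[y ->]].
  apply/forallP => z; have /allP := h _ (mem_colour_word y cs) => /(_ _ (mem_colour_word z cs)).
  by rewrite filter2_colour_word -[[:: v y; _; _; _]]/(map v [:: y; z; y; z]) (inj_eq (inj_map v_inj)).
apply/allP => _ /colour_word_mem[z ->]; move/forallP: (h y) => /(_ z).
by rewrite filter2_colour_word -[[:: v y; _; _; _]]/(map v [:: y; z; y; z]) (inj_eq (inj_map v_inj)).
Qed.

Lemma word_depth_colour_word y : word_depth colour_word (v y) = depth c y.
Proof.
congr _.+1; have /permP -> : perm_eq (undup colour_word) [seq v r | r <- enum 'I_k].
  apply: uniq_perm; rewrite ?undup_uniq ?(map_inj_uniq v_inj) ?enum_uniq //.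
  move=> z; rewrite mem_undup; apply/idP/mapP => [/colour_word_mem[r ->]|[r _ ->]].
    by exists r => //; rewrite mem_enum.
  exact: mem_colour_word.
rewrite count_map cardsE cardE size_filter enumT; apply: eq_count => x /=.
by rewrite word_inner_colour_word.
Qed.

Lemma word_ordered_colour_word m : word_ordered m colour_word =
  [forall j, forall i, ((m <= depth c j) && inner c j i) ==> (j < i)].
Proof.
apply/allP/forallP => [h y|h _ /colour_word_mem[y ->]].
  apply/forallP => z; have /allP := h _ (mem_colour_word y cs) => /(_ _ (mem_colour_word z cs)).
  by rewrite word_depth_colour_word word_inner_colour_word v_ltn.
apply/allP => _ /colour_word_mem[z ->]; move/forallP: (h y) => /(_ z).
by rewrite word_depth_colour_word word_inner_colour_word v_ltn.
Qed.

End ColourWord.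

(** This turns membership in [ONC2] into the conditions under which a word is a pairing of moment
    1. *)
Lemma ONC2_colour_word n k (c : {ffun 'I_n -> 'I_k}) (v : 'I_k -> nat) m :
  (forall r r' : 'I_k, r < r' -> v r < v r')%N -> ordpart c ->
  ONC2 c m = [&& pairword (colour_word c v), word_noncrossing (colour_word c v) & word_ordered m (colour_word c v)].
Proof.
move=> vinc co; rewrite /ONC2 /ONC co /= pairword_colour_word // andbC.
by have [cP|] //= := boolP (pair_part c); rewrite word_noncrossing_colour_word // word_ordered_colour_word.
Qed.

(** * Index words as ordered partitions with increasing labels *)

Section Standardise.
Local Open Scope nat_scope.
Variables (n M : nat).

Definition word (i : {ffun 'I_n -> 'I_M}) : seq nat := [seq (i x : nat) | x <- enum 'I_n].
Definition ffun_image (i : {ffun 'I_n -> 'I_M}) : {set 'I_M} := [set i x | x : 'I_n].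
Definition increasing_ffun k (v : {ffun 'I_k -> 'I_M}) : bool :=
  [forall r : 'I_k, forall r' : 'I_k, (r < r') ==> (v r < v r')].
Definition ffun_comp k (c : {ffun 'I_n -> 'I_k}) (v : {ffun 'I_k -> 'I_M}) :
  {ffun 'I_n -> 'I_M} := [ffun x => v (c x)].

Lemma increasing_ffunP k (v : {ffun 'I_k -> 'I_M}) :
  reflect (forall r r' : 'I_k, r < r' -> v r < v r') (increasing_ffun v).
Proof.
apply: (iffP forallP) => [h r r'|h r]; first by have /forallP/(_ r')/implyP := h r.
by apply/forallP => r'; apply/implyP; exact: h.
Qed.

Lemma increasing_ffun_inj k (v : {ffun 'I_k -> 'I_M}) : increasing_ffun v -> injective v.
Proof.
move=> /increasing_ffunP h r r' E; apply: (@v_inj _ (fun r => v r : nat) h).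
by rewrite E.
Qed.

Lemma word_ffun_comp k c (v : {ffun 'I_k -> 'I_M}) : word (ffun_comp c v) = colour_word c (fun r => v r : nat).
Proof. by apply: eq_map => x; rewrite ffunE. Qed.

Lemma ffun_image_comp k c (v : {ffun 'I_k -> 'I_M}) : increasing_ffun v -> ordpart c ->
  ffun_image (ffun_comp c v) = [set v r | r : 'I_k].
Proof.
move=> vi /forallP co; apply/setP => y; apply/imsetP/imsetP => [[x _ ->]|[r _ ->]].
  by exists (c x) => //; rewrite ffunE.
by have /existsP[x /eqP <-] := co r; exists x => //; rewrite ffunE.
Qed.

Lemma card_ffun_image_comp k c (v : {ffun 'I_k -> 'I_M}) : increasing_ffun v -> ordpart c ->
  #|ffun_image (ffun_comp c v)| = k.
Proof.
by move=> vi co; rewrite ffun_image_comp // card_imset ?card_ord //; exact: increasing_ffun_inj.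
Qed.

(** A strictly increasing map is the sorted enumeration of its image. *)
Lemma increasing_ffun_unique k (v v' : {ffun 'I_k -> 'I_M}) : increasing_ffun v -> increasing_ffun v' ->
  [set v r | r : 'I_k] = [set v' r | r : 'I_k] -> v = v'.
Proof.
move=> vi vi' E.
have so (u : {ffun 'I_k -> 'I_M}) : increasing_ffun u ->
    sorted (fun a b : 'I_M => a < b) [seq u r | r <- enum 'I_k].
  move=> /increasing_ffunP ui; rewrite sorted_map; apply: sub_sorted (sorted_enum_ord k) => a b /=.
  exact: ui.
have : [seq v r | r <- enum 'I_k] = [seq v' r | r <- enum 'I_k].
  apply: (irr_sorted_eq (leT := fun a b : 'I_M => a < b)); rewrite ?so //.
  - by move=> a b d; apply: ltn_trans.
  - by move=> a; rewrite ltnn.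
  move=> y; have /setP /(_ y) := E.
  have mE (u : {ffun 'I_k -> 'I_M}) :
      (y \in [seq u r | r <- enum 'I_k]) = (y \in [set u r | r : 'I_k]).
    by apply/mapP/imsetP => -[r _ ->]; exists r => //; rewrite mem_enum.
  by rewrite !mE.
by move/eq_in_map => h; apply/ffunP => r; apply: h; rewrite mem_enum.
Qed.

Lemma ffun_comp_inj k (c c' : {ffun 'I_n -> 'I_k}) (v v' : {ffun 'I_k -> 'I_M}) :
  increasing_ffun v -> increasing_ffun v' -> ordpart c -> ordpart c' -> ffun_comp c v = ffun_comp c' v' ->
  c = c' /\ v = v'.
Proof.
move=> vi vi' co co' E.
have vv' : v = v' by apply: increasing_ffun_unique => //; rewrite -(ffun_image_comp vi co) -(ffun_image_comp vi' co') E.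
split=> //; subst v'; apply/ffunP => x; apply: (increasing_ffun_inj vi).
by move/ffunP: E => /(_ x); rewrite !ffunE.
Qed.

Lemma standardise (i : {ffun 'I_n -> 'I_M}) :
  exists (c : {ffun 'I_n -> 'I_#|ffun_image i|}) v, [/\ increasing_ffun v, ordpart c & i = ffun_comp c v].
Proof.
have hx x : i x \in ffun_image i by apply: imset_f.
(* The colour of a position is the rank of its value among the values taken; [v] lists these values
   in increasing order. *)
exists [ffun x => enum_rank_in (hx x) (i x)], [ffun r => enum_val r].
split.
- apply/increasing_ffunP => r r' rr'; rewrite !ffunE.
  have so : sorted (fun a b : 'I_M => a < b) (enum (ffun_image i)).
    rewrite /(enum _) -enumT; apply: sorted_filter (sorted_enum_ord M).
    by move=> a b d; apply: ltn_trans.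
  have y0 := enum_val r.
  rewrite !(enum_val_nth y0).
  apply: (sorted_ltn_nth (leT := fun a b : 'I_M => a < b)) => //.
  + by move=> a b d; apply: ltn_trans.
  + by rewrite inE -cardE.
  + by rewrite inE -cardE.
- apply/forallP => r; have /imsetP[x _ rE] := enum_valP r.
  apply/existsP; exists x; rewrite ffunE; apply/eqP; apply: enum_val_inj.
  by rewrite enum_rankK_in // rE.
by apply/ffunP => x; rewrite !ffunE enum_rankK_in.
Qed.

(** A word with [d] values factors through ['I_d]; counting all pairs of maps gives the bound. *)
Lemma card_ffun_image_eq d : #|[set i | #|ffun_image i| == d]| <= d ^ n * M ^ d.
Proof.
have -> : d ^ n * M ^ d = #|[set: {ffun 'I_n -> 'I_d} * {ffun 'I_d -> 'I_M}]|.
  by rewrite cardsT card_prod !card_ffun !card_ord.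
apply: leq_trans (leq_imset_card (fun p => ffun_comp p.1 p.2) _).
apply: subset_leq_card; apply/fintype.subsetP => i; rewrite inE => /eqP di.
have [c [v [_ _ iE]]] := standardise i.
move: c v iE; rewrite di => c v iE.
by apply/imsetP; exists (c, v).
Qed.

Definition good m (w : seq nat) := [&& pairword w, word_noncrossing w & word_ordered m w].

(** By [standardise] and [ffun_comp_inj], words are in bijection with pairs of an ordered partition
    and an increasing labelling; [k] is the number of values. *)
Lemma sum_good m (Q : pred {ffun 'I_n -> 'I_M}) :
  \sum_(i | Q i) good m (word i) =
  \sum_(k < n.+1) \sum_(c : {ffun 'I_n -> 'I_k} | ONC2 c m)
    #|[set v : {ffun 'I_k -> 'I_M} | increasing_ffun v && Q (ffun_comp c v)]|.
Proof.
rewrite (eq_bigr (fun i => if good m (word i) then 1 else 0)); last first.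
  by move=> i _; case: (good _ _).
rewrite -big_mkcondr /=.
rewrite (partition_big (fun i => inord #|ffun_image i| : 'I_n.+1) predT) //=.
apply: eq_bigr => k _.
have kE i : (inord #|ffun_image i| == k) = (#|ffun_image i| == k).
  rewrite -(inj_eq val_inj) /= inordK // ltnS -[X in _ <= X](card_ord n).
  exact: leq_imset_card.
pose D := [set p : {ffun 'I_n -> 'I_k} * {ffun 'I_k -> 'I_M} |
   ONC2 p.1 m && (increasing_ffun p.2 && Q (ffun_comp p.1 p.2))].
have -> : \sum_(i | Q i && good m (word i) && (inord #|ffun_image i| == k)) 1 =
   #|[set ffun_comp p.1 p.2 | p in D]|.
  rewrite sum1_card; apply: eq_card => i; rewrite [in LHS]/in_mem /= kE.
  apply/andP/imsetP => [[/andP[Qi gi] /eqP ki]|[[c v]]].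
    have [c [v [vi co iE]]] := standardise i.
    move: c v vi co iE; rewrite ki => c v vi co iE; exists (c, v) => //.
    rewrite inE /= vi -iE Qi (@ONC2_colour_word _ _ _ (fun r => v r)) //; last exact/increasing_ffunP.
    by move: gi; rewrite /good -word_ffun_comp -iE => ->.
  rewrite inE /= => /and3P[oc vi Qc] ->.
  have co : ordpart c by move: oc => /andP[/and3P[]].
  rewrite Qc card_ffun_image_comp // eqxx /good word_ffun_comp -ONC2_colour_word //; exact/increasing_ffunP.
rewrite card_in_imset; last first.
  move=> [c v] [c' v']; rewrite !inE /= => /and3P[oc vi _] /and3P[oc' vi' _] E.
  have co : ordpart c by move: oc => /andP[/and3P[]].
  have co' : ordpart c' by move: oc' => /andP[/and3P[]].
  by have [-> ->] := ffun_comp_inj vi vi' co co' E.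
rewrite -sum1_card.
rewrite (eq_bigl (fun p : _ * _ => ONC2 p.1 m && (increasing_ffun p.2 && Q (ffun_comp p.1 p.2)))); last first.
  by move=> p; rewrite inE.
rewrite -(pair_big_dep (fun c => ONC2 c m) (fun c v => increasing_ffun v && Q (ffun_comp c v))
  (fun _ _ => 1)) /=.
by apply: eq_bigr => c _; rewrite sum1_card cardsE.
Qed.

(** Every value occurs at least twice and some value at least three times, while the multiplicities
    add up to [n]. *)
Lemma ffun_image_lt_half (i : {ffun 'I_n -> 'I_M}) :
  (forall z, count_mem z (word i) != 1) -> ~~ pairword (word i) -> #|ffun_image i|.*2 < n.
Proof.
move=> h1 np.
have cE (y : 'I_M) : count_mem (y : nat) (word i) = \sum_(x | i x == y) 1.
  rewrite /word count_map sum1_card cardE size_filter enumT; apply: eq_count => x /=.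
  by rewrite (inj_eq val_inj).
have nE : n = \sum_(y in ffun_image i) count_mem (y : nat) (word i).
  rewrite -[LHS](card_ord n) -sum1_card (partition_big i (mem (ffun_image i))) /=.
    by apply: eq_bigr => y _; rewrite cE.
  by move=> x _; apply: imset_f.
have c2 (y : 'I_M) : y \in ffun_image i -> 2 <= count_mem (y : nat) (word i).
  move=> /imsetP[x _ ->]; have := h1 (i x : nat).
  have : 0 < count_mem (i x : nat) (word i).
    by rewrite -has_count has_pred1; apply/mapP; exists x => //; rewrite mem_enum.
  by case: (count_mem _ _) => [|[|]].
have /allPn[z zw zc] := np.
have [x zE] : exists x, z = i x :> nat by move/mapP: zw => [x _ ->]; exists x.
have xin : i x \in ffun_image i by apply: imset_f.
rewrite nE (bigD1 (i x)) //= (cardsD1 (i x)) xin add1n doubleS.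
have : #|ffun_image i :\ i x|.*2 <= \sum_(y in ffun_image i | y != i x) count_mem (y : nat) (word i).
  rewrite -muln2 -sum_nat_const (eq_bigl (fun y => (y \in ffun_image i) && (y != i x))); last first.
    by move=> y; rewrite !inE andbC.
  by apply: leq_sum => y /andP[/c2].
have := c2 _ xin; rewrite -zE; move: zc.
case: (count_mem z (word i)) => [|[|[|q]]] // _ _ h.
by rewrite !addSn !ltnS; exact: leq_trans h (leq_addl _ _).
Qed.

End Standardise.

(** * Counting increasing labellings *)

Section IncreasingCount.
Local Open Scope nat_scope.

(** Hockey-stick identity: [y] is the least element of a set of [p + 1] integers in []c, b]].
    Splitting off [y = c + 1] is Pascal's rule. *)
Lemma sum_bin_itv M c b p : b < M ->
  \sum_(y < M | c < y <= b) 'C(b - y, p) = 'C(b - c, p.+1).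
Proof.
move=> bM; have [d] := ubnP (b - c); elim: d c => // d IH c.
rewrite ltnS => hd; case: (ltnP c b) => cb; last first.
  rewrite big_pred0 => [|y]; first by rewrite (eqP cb).
  by apply/negP => /andP[cy yb]; have := leq_trans (leq_trans cy yb) cb; rewrite ltnn.
have cM : c.+1 < M by exact: leq_ltn_trans bM.
rewrite (bigD1 (Ordinal cM)) /=; last by rewrite ltnSn.
rewrite (eq_bigl (fun y : 'I_M => c.+1 < y <= b)); last first.
  move=> y; rewrite -(inj_eq val_inj) /= (ltn_neqAle c.+1) eq_sym.
  by case: (c < y); case: (y <= b); case: (_ == _).
rewrite IH; last by apply: leq_trans hd; rewrite ltn_sub2l.
by rewrite -(subnSK cb) binS addnC.
Qed.

Variables (d : Order.disp_t) (T : orderType d) (a b : T -> nat) (M : nat).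

(** The number of strictly increasing sequences above [lo] whose entries lie in the intervals []a x,
    b x]] prescribed by [l]. *)
Fixpoint count_increasing lo (l : seq T) : nat :=
  if l is x :: l' then \sum_(y < M | (lo < y) && (a x < y <= b x)) count_increasing y l' else 1.

(** The bound [lo] is general for the induction. It cuts only the interval of the first label,
    whence the [maxn]; the later intervals lie to the right and stay whole. *)
Lemma count_increasing_cons (U : seq T) lo x l : uniq U -> {subset x :: l <= U} ->
  (forall z, z \in U -> b z < M) ->
  (forall z z', z \in U -> z' \in U -> (z < z')%O -> b z <= a z') ->
  sorted <=%O (x :: l) ->
  count_increasing lo (x :: l) = 'C(b x - maxn (a x) lo, count_mem x (x :: l)) *
    \prod_(z <- U | z != x) 'C(b z - a z, count_mem z l).
Proof.
move=> uU + bM bA; elim: l x lo => [|z l IH] x lo sU so.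
  have xU : x \in U by apply: sU; rewrite mem_head.
  rewrite /= eqxx /= [X in _ * X]big1 ?muln1; last by move=> z _; rewrite bin0.
  rewrite -(sum_bin_itv _ _ (bM _ xU)); apply: eq_big => [y|y _]; last by rewrite bin0.
  by rewrite gtn_max; case: (lo < y); case: (a x < y).
have xU : x \in U by apply: sU; rewrite mem_head.
have zU : z \in U by apply: sU; rewrite !inE eqxx orbT.
have sU' : {subset z :: l <= U} by move=> y yl; apply: sU; rewrite inE yl orbT.
have [/= xz so'] := andP so.
move: (xz); rewrite le_eqVlt => /orP[/eqP xz'|xz'].
  (* The same label again: the choices of the first entry add up by [sum_bin_itv]. *)
  subst z; rewrite [LHS]/=.
  under eq_bigr => y /andP[_ /andP[ay _]] do rewrite -/(count_increasing y (x :: l)) (IH x y) // (maxn_idPr (ltnW ay)).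
  rewrite -big_distrl /=; congr (_ * _); last first.
    by apply: eq_bigr => u ux; rewrite eq_sym (negbTE ux).
  rewrite eqxx !add1n -(sum_bin_itv _ _ (bM _ xU)); apply: eq_bigl => y.
  by rewrite gtn_max; case: (lo < y); case: (a x < y).
have xl : x \notin z :: l.
  apply/negP => xl; have /allP /(_ x xl) : all (<=%O z) (z :: l).
    by rewrite /= lexx; apply: order_path_min so'; exact: le_trans.
  by rewrite leNgt xz'.
have cE (y : 'I_M) : y <= b x -> count_increasing y (z :: l) =
    \prod_(u <- U | u != x) 'C(b u - a u, count_mem u (z :: l)).
  move=> yb; rewrite (IH z y) // (maxn_idPl (leq_trans yb (bA _ _ xU zU xz'))).
  transitivity (\prod_(u <- U) 'C(b u - a u, count_mem u (z :: l))); last first.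
    by rewrite (bigD1_seq x) //=; move/count_memPn: xl => /= ->; rewrite bin0 mul1n.
  rewrite [RHS](bigD1_seq z) //=; congr (_ * _); apply: eq_bigr => u uz.
  by rewrite eq_sym (negbTE uz).
rewrite [LHS]/=.
under eq_bigr => y /andP[_ /andP[_ yb]] do rewrite -/(count_increasing y (z :: l)) cE //.
rewrite sum_nat_const -[X in _ = 'C(_, X) * _]/((x == x) + count_mem x (z :: l)).
move/count_memPn: (xl) => ->; rewrite eqxx addn0 bin1; congr (_ * _).
rewrite -sum1_card -[RHS]bin1 -(sum_bin_itv _ _ (bM _ xU)).
apply: eq_big => [y|y _]; last by rewrite bin0.
by rewrite /in_mem /= gtn_max; case: (lo < y); case: (a x < y).
Qed.

Lemma count_increasing_prod (U l : seq T) : uniq U -> {subset l <= U} ->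
  (forall z, z \in U -> b z < M) ->
  (forall z z', z \in U -> z' \in U -> (z < z')%O -> b z <= a z') ->
  sorted <=%O l ->
  count_increasing 0 l = \prod_(z <- U) 'C(b z - a z, count_mem z l).
Proof.
case: l => [|x l] uU sU bM bA so; first by rewrite big1 // => z _; rewrite bin0.
rewrite (count_increasing_cons 0 uU) // maxn0 [RHS](bigD1_seq x) //=; last by apply: sU; rewrite mem_head.
by congr (_ * _); apply: eq_bigr => u ux; rewrite eq_sym (negbTE ux).
Qed.

Lemma all2_map (I S1 S2 : Type) (P : S1 -> S2 -> bool) (f : I -> S1) (g : I -> S2) s :
  all2 P [seq f r | r <- s] [seq g r | r <- s] = all (fun r => P (f r) (g r)) s.
Proof. by elim: s => //= r s ->. Qed.

Definition increasing_in lo (l : seq T) (t : seq 'I_M) : bool :=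
  path ltn lo (map val t) && all2 (fun x (y : 'I_M) => a x < y <= b x) l t.

Lemma sum_tuple_cons k (F : k.+1.-tuple 'I_M -> nat) :
  \sum_t F t = \sum_y \sum_(t : k.-tuple 'I_M) F [tuple of y :: t].
Proof.
rewrite pair_big /= (reindex (fun p : 'I_M * k.-tuple 'I_M => [tuple of p.1 :: p.2])) //=.
exists (fun t => (thead t, [tuple of behead t])) => [[y t] _|t _] /=.
  by congr pair; apply: val_inj.
by rewrite [RHS]tuple_eta.
Qed.

Lemma sum_increasing_in k lo l : size l = k -> \sum_(t : k.-tuple 'I_M) increasing_in lo l t = count_increasing lo l.
Proof.
elim: k lo l => [|k IH] lo [|x l] //= => [_|[sl]].
  rewrite (eq_bigr (fun=> 1)) => [|t _]; last by rewrite tuple0.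
  by rewrite sum1_card card_tuple expn0.
rewrite sum_tuple_cons [RHS]big_mkcond /=; apply: eq_bigr => y _.
rewrite -(IH y l sl); case: ifP => h; [apply: eq_bigr | rewrite big1 //] => t _.
  by rewrite /increasing_in /=; case/andP: h => -> ->.
by rewrite /increasing_in /=; move: h; case: (lo < y) => //= ->; rewrite andbF.
Qed.

Lemma card_increasing_itv k (block_label : 'I_k -> T) :
  #|[set v : {ffun 'I_k -> 'I_M} | increasing_ffun v && [forall r, a (block_label r) < v r <= b (block_label r)]]| =
  count_increasing 0 [seq block_label r | r <- enum 'I_k].
Proof.
rewrite -(@sum_increasing_in k); last by rewrite size_map size_enum_ord.
rewrite -sum1_card (reindex (fun v : {ffun 'I_k -> 'I_M} => [tuple v r | r < k])) /=; last first.
  exists (fun t => [ffun r => tnth t r]) => [v _|t _].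
    by apply/ffunP => r; rewrite ffunE tnth_mktuple.
  by apply: eq_from_tnth => r; rewrite tnth_mktuple ffunE.
rewrite big_mkcond /=; apply: eq_bigr => v _; rewrite inE /increasing_in.
have -> : all2 (fun x (y : 'I_M) => a x < y <= b x) [seq block_label r | r <- enum 'I_k]
    [tuple v r | r < k] = [forall r, a (block_label r) < v r <= b (block_label r)].
  rewrite /= all2_map; apply/allP/forallP => [h r|h r _]; last exact: h.
  by apply: h; rewrite mem_enum.
have [/forallP h|] := boolP [forall r, a (block_label r) < v r <= b (block_label r)]; last by rewrite !andbF.
rewrite !andbT /= -map_comp.
(* Starting the path at 0 is harmless: every entry exceeds some [a], hence is positive. *)
have -> : path ltn 0 [seq (val \o v) r | r <- enum 'I_k] = increasing_ffun v.
  rewrite path_sortedE; last exact: ltn_trans.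
  have -> : all (ltn 0) [seq (val \o v) r | r <- enum 'I_k].
    apply/allP => _ /mapP[r _ ->] /=; have /andP[h1 _] := h r; exact: leq_ltn_trans h1.
  rewrite /= sorted_map; apply/idP/increasing_ffunP => [so r r' rr'|vi].
    have tr : transitive (relpre (val \o v) ltn) by move=> x y z; apply: ltn_trans.
    have := sorted_ltn_nth tr r so (r : nat) (r' : nat).
    by rewrite !inE size_enum_ord !ltn_ord !nth_ord_enum /=; apply.
  by apply: sub_sorted (sorted_enum_ord k) => x y /=; exact: vi.
by case: (increasing_ffun v).
Qed.

End IncreasingCount.

(** * Indicator functions of intervals *)

Section Chi.
Variable R : realType.
Implicit Types s t : R.

Lemma chiE s t x : chi s t x = (s < x <= t)%R%:R.
Proof. by rewrite /chi indicE mem_setE in_itv. Qed.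

Lemma itv_sub_ends s t s' t' : s < t ->
  (forall x, s < x <= t -> s' < x <= t') -> s' <= s /\ t <= t'.
Proof.
move=> st h; split; last by have := h t; rewrite st lexx => /(_ isT) /andP[].
rewrite leNgt; apply/negP => ss'.
(* If [s < s'], this point belongs to []s, t]] but lies to the left of [s']. *)
have := h (Num.min ((s + s') / 2) t).
rewrite lt_min ge_min lexx orbT st andbT midf_lt // => /(_ isT) /andP[].
by rewrite lt_min => /andP[]; rewrite ltNge => /negP + _ _; apply; rewrite midf_le // ltW.
Qed.

Lemma chi_inj s t s' t' : s < t -> s' < t' -> chi s t = chi s' t' -> s = s' /\ t = t'.
Proof.
move=> st st' E.
have e x : (s < x <= t) = (s' < x <= t').
  have : chi s t x = chi s' t' x by rewrite E.
  by rewrite !chiE => /eqP; rewrite eqr_nat; case: (_ && _); case: (_ && _).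
have [||h1 h2] := @itv_sub_ends s t s' t' => //; first by move=> x; rewrite e.
have [||h3 h4] := @itv_sub_ends s' t' s t => //; first by move=> x; rewrite e.
by split; apply/eqP; rewrite eq_le ?h1 ?h2 ?h3 ?h4.
Qed.

Lemma chi_disjoint s t s' t' : s < t -> s' < t' ->
  (supp (chi s t) `&` supp (chi s' t') = set0)%classic -> t <= s' \/ t' <= s.
Proof.
move=> st st' E; case: (leP t s') => h1; first by left.
case: (leP t' s) => h2; first by right.
(* The smaller right end of two overlapping intervals lies in both. *)
exfalso; have : (supp (chi s t) `&` supp (chi s' t'))%classic (Num.min t t').
  split; rewrite /supp /= chiE lt_min ge_min lexx ?orbT ?andbT ?st ?h1 ?h2 ?st' oner_eq0 //.
by rewrite E.
Qed.

Lemma ipL2_chi s t : 0 <= s -> s < t -> ipL2 (chi s t) (chi s t) = t - s.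
Proof.
move=> s0 st; rewrite /ipL2.
have -> : (fun x => (chi s t x * chi s t x)%:E) = (fun x => (\1_(`]s, t]%classic) x)%:E).
  apply: funext => x; rewrite chiE indicE mem_setE in_itv /=.
  by case: (_ && _); rewrite ?mulr1 ?mulr0.
rewrite integral_indic //= setIidl; last first.
  by move=> x /=; rewrite !in_itv /= andbT => /andP[sx _]; rewrite (le_trans s0) // ltW.
by rewrite lebesgue_measure_itv /= lte_fin st.
Qed.

End Chi.

Lemma sum_count_mem (T : eqType) (U l : seq T) : uniq U -> {subset l <= U} ->
  (\sum_(u <- U) count_mem u l = size l)%N.
Proof.
move=> uU; elim: l => [|x l IH] sU /=; first by rewrite big1.
rewrite big_split /= IH; last by move=> y yl; apply: sU; rewrite inE yl orbT.
rewrite (bigD1_seq x) //=; last by apply: sU; rewrite mem_head.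
by rewrite eqxx big1 ?addn0 ?add1n // => u /negbTE; rewrite eq_sym => ->.
Qed.

Lemma prod_count_mem (T : eqType) (K : comNzRingType) (F : T -> K) (U l : seq T) :
  uniq U -> {subset l <= U} ->
  \prod_(u <- U) F u ^+ count_mem u l = \prod_(x <- l) F x.
Proof.
move=> uU; elim: l => [|x l IH] sU /=; first by rewrite big_nil big1.
under eq_bigr => u _ do rewrite exprD.
rewrite big_split /= big_cons IH; last by move=> y yl; apply: sU; rewrite inE yl orbT.
rewrite (bigD1_seq x) //=; last by apply: sU; rewrite mem_head.
by rewrite eqxx expr1 big1 ?mulr1 // => u /negbTE; rewrite eq_sym => ->.
Qed.

(** * The family of intervals and its compatible colourings *)

Section Labels.
Variables (R : realType) (n : nat) (s t : 'I_n -> R).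
Hypothesis st : forall j, s j < t j.
Hypothesis sep : forall j l, (s j = s l /\ t j = t l) \/ t j <= s l \/ t l <= s j.

Lemma right_end_eq j l : s j = s l -> t j = t l.
Proof.
move=> sj; case: (sep j l) => [[]//|[h|h]].
  by have := st j; rewrite sj ltNge h.
by have := st l; rewrite -sj ltNge h.
Qed.

Lemma s_lt_t j l : s j < s l -> t j <= s l.
Proof.
move=> sj; case: (sep j l) => [[sjl _]|[//|h]]; first by move: sj; rewrite sjl ltxx.
by have := lt_trans (lt_le_trans (st l) h) sj; rewrite ltxx.
Qed.

Lemma chi_eqP j l : chi (s j) (t j) = chi (s l) (t l) <-> s j = s l.
Proof.
split=> [/chi_inj [] //|sjl]; by rewrite sjl (right_end_eq sjl).
Qed.

(** Within a family of equal or disjoint intervals, the partial order is the total order of left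
    ends. *)
Lemma theta_leP j l : theta_le (s j) (t j) (s l) (t l) <-> s j <= s l.
Proof.
split; first by move=> [h|/chi_eqP ->//]; rewrite (le_trans (ltW (st j))).
rewrite le_eqVlt => /orP[/eqP /chi_eqP|/s_lt_t]; by [right|left].
Qed.

(* An interval of the family is determined by its left end, used as its label. *)
Definition right_end (u : R) : R := if [pick x | s x == u] is Some x then t x else u.

Lemma right_endE x : right_end (s x) = t x.
Proof.
rewrite /right_end; case: pickP => [y /eqP /right_end_eq //|/(_ x)]; by rewrite eqxx.
Qed.

Definition labels : seq R := undup [seq s x | x <- enum 'I_n].

Lemma labelsP u : reflect (exists x, u = s x) (u \in labels).
Proof.
rewrite mem_undup; apply: (iffP mapP) => [[x _ ->]|[x ->]]; first by exists x.
by exists x => //; rewrite mem_enum.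
Qed.

Definition label_class (u : R) : {set 'I_n} := [set x | s x == u].
Definition half_card (u : R) : nat := #|label_class u| %/ 2.

Lemma prod_sigma (F : {set 'I_n} -> R) :
  \prod_(B in sigma_part s t) F B = \prod_(u <- labels) F (label_class u).
Proof.
rewrite -big_enum /= -(big_map label_class predT F); apply: perm_big; apply: uniq_perm.
- exact: enum_uniq.
- rewrite map_inj_in_uniq ?undup_uniq // => u u' /labelsP[x ->] /labelsP[x' ->] /setP/(_ x).
  by rewrite !inE eqxx => /esym /eqP.
have E j : [set l | `[< chi (s j) (t j) = chi (s l) (t l) >]] = label_class (s j).
  by apply/setP => l; rewrite !inE; apply/asboolP/eqP => [/chi_eqP|/esym /chi_eqP].
move=> B; rewrite mem_enum; apply/imsetP/mapP => [[j _ ->]|[u /labelsP[j ->] ->]].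
  by exists (s j) => //; apply/labelsP; exists j.
by exists j.
Qed.

Section Compat.
Variables (k : nat) (c : {ffun 'I_n -> 'I_k}).

Definition compatb : bool :=
  [forall x, forall y, (c x == c y) ==> (s x == s y)] &&
  [forall x, forall y, (c x < c y)%N ==> (s x <= s y)].

Lemma compatibleP : `[< compatible c s t >] = compatb.
Proof.
apply/asboolP/andP => [[h1 h2]|[/forallP h1 /forallP h2]].
  split; apply/forallP => x; apply/forallP => y; apply/implyP.
    by move=> /eqP /h1 /chi_eqP ->.
  by move=> /h2 /theta_leP.
split=> x y.
  by move=> cxy; apply/chi_eqP; have /forallP/(_ y) := h1 x; rewrite cxy eqxx => /eqP.
by move=> cxy; apply/theta_leP; have /forallP/(_ y) := h2 x; rewrite cxy.
Qed.

(** The common left end of the intervals in block [r]; the default 0 does not occur when the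
    colouring is onto. *)
Definition block_label (r : 'I_k) : R := if [pick x | c x == r] is Some x then s x else 0.

Hypothesis cc : compatb.
Hypothesis co : ordpart c.
Hypothesis cP : pair_part c.

Lemma compat_eq x y : c x = c y -> s x = s y.
Proof.
by move=> cxy; have /andP[/forallP /(_ x) /forallP /(_ y) + _] := cc; rewrite cxy eqxx => /eqP.
Qed.

Lemma compat_le x y : (c x < c y)%N -> s x <= s y.
Proof. by move=> cxy; have /andP[_ /forallP /(_ x) /forallP /(_ y)] := cc; rewrite cxy. Qed.

Lemma block_labelE x : block_label (c x) = s x.
Proof.
rewrite /block_label; case: pickP => [y /eqP /compat_eq //|/(_ x)]; by rewrite eqxx.
Qed.

Lemma ordpart_surj r : exists x, c x = r.
Proof. by move/forallP: co => /(_ r) /existsP[x /eqP]; exists x. Qed.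

Definition block_labels := [seq block_label r | r <- enum 'I_k].

Lemma block_labels_sub : {subset block_labels <= labels}.
Proof.
by move=> u /mapP[r _ ->]; have [x <-] := ordpart_surj r; apply/labelsP; exists x; rewrite block_labelE.
Qed.

Lemma block_labels_sorted : sorted <=%O block_labels.
Proof.
rewrite sorted_map; apply: sub_sorted (sorted_enum_ord k) => r r' /=.
by have [x <-] := ordpart_surj r; have [y <-] := ordpart_surj r'; rewrite !block_labelE; exact: compat_le.
Qed.

(** A block with label [u] takes two positions of the class of [u]. The count therefore depends on
    the family alone, and all compatible pairings have the same limit. *)
Lemma count_block_labels u : count_mem u block_labels = half_card u.
Proof.
rewrite /half_card; have -> : #|label_class u| = (count_mem u block_labels * 2)%N; last by rewrite mulnK.
rewrite /block_labels count_map -size_filter -sum1_size big_filter big_distrl /= big_enum_cond /=.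
rewrite -sum1_card (partition_big c (fun r => block_label r == u)) /=.
  apply: eq_bigr => r /eqP ru; rewrite mul1n -(card_colour cP r) -sum1_card.
  apply: eq_bigl => x; rewrite !inE; apply: andb_idl => /eqP cx.
  by rewrite -block_labelE cx ru.
by move=> x; rewrite inE block_labelE.
Qed.

Lemma sum_half_card : (\sum_(u <- labels) half_card u = k)%N.
Proof.
under eq_bigr => u _ do rewrite -count_block_labels.
rewrite sum_count_mem ?undup_uniq //; last exact: block_labels_sub.
by rewrite size_map size_enum_ord.
Qed.

Lemma pair_n : n = k.*2.
Proof.
rewrite -[LHS](card_ord n) -sum1_card (partition_big c predT) //=.
rewrite (eq_bigr (fun=> 2%N)); last first.
  by move=> r _; rewrite -(card_colour cP r) -sum1_card; apply: eq_bigl => x; rewrite inE.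
by rewrite sum_nat_const card_ord muln2.
Qed.

(** Each block contributes its single pair, whose inner product is the length of the interval;
    blocks are then grouped by label. *)
Lemma prod_ip : (forall j, 0 <= s j) ->
  \prod_(a : 'I_n) \prod_(b : 'I_n | (a < b)%N && (c a == c b))
     ipL2 (chi (s a) (t a)) (chi (s b) (t b)) =
  \prod_(u <- labels) (right_end u - u) ^+ half_card u.
Proof.
move=> s0.
transitivity (\prod_(r < k) (right_end (block_label r) - block_label r)).
  rewrite (partition_big c predT) //=; apply: eq_bigr => r _.
  have /cards2P [a' [b' [ab' abE']]] : #|[set x | c x == r]| == 2 by rewrite card_colour.
  have [a [b [ab abE]]] : exists a b : 'I_n, (a < b)%N /\ [set x | c x == r] = [set a; b].
    case: (ltngtP a' b') => h; [by exists a', b'|by exists b', a'; rewrite finset.setUC|].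
    by move/val_inj: h ab' => ->; rewrite eqxx.
  have cE x : (c x == r) = (x == a) || (x == b).
    by move/setP: abE => /(_ x); rewrite !inE.
  have ca : c a = r by apply/eqP; rewrite cE eqxx.
  have cb : c b = r by apply/eqP; rewrite cE eqxx orbT.
  have neq : a != b by rewrite -(inj_eq val_inj) /= neq_ltn ab.
  rewrite (bigD1 a) /= ?ca // [X in _ * X](bigD1 b) /=; last by rewrite cb eqxx eq_sym neq.
  rewrite [X in _ * (_ * X)]big1; last first.
    by move=> x; rewrite cE; case: (x == a); case: (x == b).
  rewrite mulr1 [X in _ * X]big_pred0; last first.
    move=> x; apply/negP => /andP[bx]; rewrite cb eq_sym cE => /orP[] /eqP xE.
      by move: bx; rewrite xE ltnNge ltnW.
    by move: bx; rewrite xE ltnn.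
  rewrite mulr1 (bigD1 b) /=; last by rewrite ab cb eqxx.
  rewrite [X in _ * X]big_pred0 ?mulr1; last first.
    move=> x; apply/negP => /andP[/andP[ax]]; rewrite eq_sym cE => /orP[] /eqP xE.
      by move: ax; rewrite xE ltnn.
    by rewrite xE eqxx.
  have sab : s a = s b by apply: compat_eq; rewrite ca cb.
  by rewrite -sab -(right_end_eq sab) ipL2_chi // -ca block_labelE right_endE.
under [RHS]eq_bigr => u _ do rewrite -count_block_labels.
rewrite prod_count_mem ?undup_uniq //; last exact: block_labels_sub.
by rewrite big_map big_enum.
Qed.

End Compat.
End Labels.

(** * Asymptotics *)

Section Limits.
Local Open Scope classical_set_scope.
Variable R : realType.

Lemma cvg_div_nat (u : nat -> R) (l K : R) :
  (forall N, `|u N - l * N%:R| <= K) -> u N / N%:R @[N --> \oo] --> l.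
Proof.
move=> h; apply/cvgrPdist_lt => e e0; near=> N.
have NK : `|K| / e < N%:R by near: N; exact: nbhs_infty_gtr.
have N0 : 0 < N%:R :> R by apply: le_lt_trans NK; rewrite divr_ge0 // ltW.
have -> : l - u N / N%:R = (l * N%:R - u N) / N%:R.
  by rewrite mulrBl mulfK // gt_eqF.
rewrite normrM normfV (gtr0_norm N0) distrC ltr_pdivrMr //.
apply: le_lt_trans (h N) _; apply: le_lt_trans (ler_norm K) _.
by rewrite mulrC -ltr_pdivrMr.
Unshelve. all: by end_near. Qed.

Lemma truncn_dist (x : R) : 0 <= x -> `|(Num.truncn x)%:R - x| <= 1.
Proof.
move=> /truncn_itv /andP[h1 h2]; rewrite ler_distl; move: h2; rewrite -natr1; lra.
Qed.

(** The binomial is a product of [b] factors [L N - i] over [b!], and each factor divided by [N]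
    tends to [l]. *)
Lemma cvg_bin (L : nat -> nat) (l K : R) b :
  (forall N, `|(L N)%:R - l * N%:R| <= K) ->
  ('C(L N, b))%:R * (N%:R^-1) ^+ b @[N --> \oo] --> l ^+ b / (b`!)%:R.
Proof.
move=> h.
have E N : ('C(L N, b))%:R * (N%:R^-1) ^+ b =
    (\prod_(i < b) ((L N - i)%N%:R / N%:R)) * (b`!)%:R^-1 :> R.
  rewrite big_split /= prodr_const card_ord mulrAC; congr (_ * _).
  rewrite -natr_prod -ffact_prod -bin_ffact natrM mulfK //.
under eq_fun do rewrite E.
apply: cvgM; last exact: cvg_cst.
rewrite -[X in l ^+ X](card_ord b) -prodr_const.
apply: (cvg_big (U := R) (op := @GRing.mul R)) => [|i _]; first exact: mul_continuous.
(* The truncated difference is within [i] of [L N], whence the constant. *)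
apply: (@cvg_div_nat _ _ (K + i%:R)) => N.
have -> : (L N - i)%N%:R = (L N)%:R - (minn (L N) i)%:R :> R.
  by rewrite -natrB ?geq_minl // ; congr (_%:R); lia.
rewrite addrAC; apply: le_trans (ler_normB _ _) _; apply: lerD => //.
by rewrite normr_nat ler_nat geq_minr.
Qed.

Lemma inv_sqrt_small (C e : R) : 0 < e ->
  exists N0, forall N, (N0 <= N)%N -> C * (Num.sqrt N%:R)^-1 < e.
Proof.
move=> e0; exists (Num.truncn ((C / e) ^+ 2)).+1 => N hN.
have h : (C / e) ^+ 2 < N%:R.
  have /andP[_ h] := truncn_itv (sqr_ge0 (C / e)).
  by apply: lt_le_trans h _; rewrite ler_nat.
have N0 : 0 < N%:R :> R by apply: le_lt_trans h; exact: sqr_ge0.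
have s0 : 0 < Num.sqrt N%:R :> R by rewrite sqrtr_gt0.
rewrite ltr_pdivrMr // -ltr_pdivrMl //; apply: le_lt_trans (ler_norm _) _.
by rewrite -[`|_|]sqrtr_sqr ltr_sqrt // mulrC.
Qed.

End Limits.

(** * The normalised sum over the index words of the family *)

Section Asymptotics.
Local Open Scope classical_set_scope.
Variables (R : realType) (n : nat) (s t : 'I_n -> R).
Hypothesis s_ge0 : forall j, 0 <= s j.
Hypothesis st : forall j, s j < t j.
Hypothesis sep : forall j l, (s j = s l /\ t j = t l) \/ t j <= s l \/ t l <= s j.

Local Notation lo N x := (Num.truncn (s x * N%:R)).
Local Notation hi N x := (Num.truncn (t x * N%:R)).

Definition in_range N M (i : {ffun 'I_n -> 'I_M}) : bool :=
  [forall x, lo N x < i x <= hi N x]%N.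

(** The number [L_u] of indices available to the interval with left end [u]. *)
Definition width N (u : R) : nat :=
  (Num.truncn (right_end s t u * N%:R) - Num.truncn (u * N%:R))%N.

Lemma hi_le_lo N j l : s j < s l -> (hi N j <= lo N l)%N.
Proof. by move=> /(s_lt_t st sep) h; apply: le_truncn; rewrite ler_wpM2r. Qed.

Lemma card_compat N M k (c : {ffun 'I_n -> 'I_k}) : (forall x, hi N x < M)%N ->
  compatb s c -> ordpart c -> pair_part c ->
  #|[set v : {ffun 'I_k -> 'I_M} | increasing_ffun v && in_range N (ffun_comp c v)]%SET| =
  (\prod_(u <- labels s) 'C(width N u, half_card s u))%N.
Proof.
move=> hM cc co cP.
pose a (u : R) := Num.truncn (u * N%:R); pose b u := Num.truncn (right_end s t u * N%:R).
have E : [set v : {ffun 'I_k -> 'I_M} | increasing_ffun v && in_range N (ffun_comp c v)]%SET =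
   [set v : {ffun 'I_k -> 'I_M} |
     increasing_ffun v && [forall r, a (block_label s c r) < v r <= b (block_label s c r)]%N]%SET.
  apply/setP => v; rewrite !inE; congr (_ && _); apply/forallP/forallP => h.
    move=> r; have [x <-] := ordpart_surj co r; have := h x.
    by rewrite ffunE /a /b (block_labelE cc) (right_endE st sep).
  by move=> x; have := h (c x); rewrite ffunE /a /b (block_labelE cc) (right_endE st sep).
rewrite E card_increasing_itv (@count_increasing_prod _ _ _ _ _ (labels s)).
- by apply: eq_bigr => u _; rewrite (count_block_labels cc cP).
- exact: undup_uniq.
- exact: block_labels_sub.
- by move=> u /labelsP[x ->]; rewrite /b (right_endE st sep).
- move=> u u' /labelsP[x ->] /labelsP[x' ->] uu'.
  by rewrite /b /a (right_endE st sep); exact: hi_le_lo.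
exact: block_labels_sorted.
Qed.

(** Indices taken from different intervals are ordered like the intervals, so a word within the
    ranges induces a compatible colouring. *)
Lemma card_incompat N M k (c : {ffun 'I_n -> 'I_k}) : ~~ compatb s c ->
  #|[set v : {ffun 'I_k -> 'I_M} | increasing_ffun v && in_range N (ffun_comp c v)]%SET| = 0%N.
Proof.
move=> nc; apply/eqP; rewrite cards_eq0; apply/eqP/setP => v; rewrite !inE.
apply/negP => /andP[/increasing_ffunP vi /forallP vr].
have {}vr x : (lo N x < v (c x) <= hi N x)%N by have := vr x; rewrite ffunE.
have key x y : s x < s y -> (v (c x) < v (c y))%N.
  move=> /(hi_le_lo N) h; have /andP[_ h1] := vr x; have /andP[h2 _] := vr y.
  exact: leq_ltn_trans (leq_trans h1 h) h2.
move/negP: nc; apply; apply/andP; split; apply/forallP => x; apply/forallP => y; apply/implyP.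
  by move=> /eqP cxy; case: (ltgtP (s x) (s y)) => // /key; rewrite cxy ltnn.
move=> /vi vxy; rewrite leNgt; apply/negP => /key h.
by have := ltn_trans vxy h; rewrite ltnn.
Qed.

Definition scale N : R := (Num.sqrt N%:R)^-1 ^+ n.

Lemma scale_pair N k : n = k.*2 -> scale N = N%:R^-1 ^+ k.
Proof.
by move=> nk; rewrite /scale {1}nk -mul2n exprM exprVn sqr_sqrtr ?ler0n.
Qed.

Lemma width_dist N u : u \in labels s -> `|(width N u)%:R - (right_end s t u - u) * N%:R| <= 2.
Proof.
move=> /labelsP[x ->]; rewrite /width (right_endE st sep).
have h1 : `|(lo N x)%:R - s x * N%:R| <= 1 by apply: truncn_dist; rewrite mulr_ge0.
have h2 : `|(hi N x)%:R - t x * N%:R| <= 1.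
  by apply: truncn_dist; rewrite mulr_ge0 // (le_trans (s_ge0 x)) // ltW.
rewrite natrB; last by apply: le_truncn; rewrite ler_wpM2r // ltW.
move: h1 h2; rewrite !ler_distl; lra.
Qed.

(** The limit contributed by one compatible ordered pairing. *)
Definition limit_term : R :=
  \prod_(u <- labels s) ((right_end s t u - u) ^+ half_card s u / ((half_card s u)`!)%:R).

Lemma cvg_compat (M : nat -> nat) k (c : {ffun 'I_n -> 'I_k}) :
  (forall N x, hi N x < M N)%N -> ordpart c -> pair_part c ->
  scale N * #|[set v : {ffun 'I_k -> 'I_(M N)} | increasing_ffun v && in_range N (ffun_comp c v)]%SET|%:R
    @[N --> \oo] --> (if compatb s c then limit_term else 0).
Proof.
move=> hM co cP; have [cc|nc] := boolP (compatb s c); last first.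
  under eq_fun do rewrite card_incompat // mulr0.
  exact: cvg_cst.
(* The power of [1 / N] is shared out among the labels by [sum_half_card]; the membership condition
   is kept for [width_dist]. *)
have E N : scale N * #|[set v : {ffun 'I_k -> 'I_(M N)} | increasing_ffun v && in_range N (ffun_comp c v)]%SET|%:R =
    \prod_(u <- labels s | u \in labels s) ('C(width N u, half_card s u)%:R * N%:R^-1 ^+ half_card s u).
  rewrite card_compat // (scale_pair N (pair_n cP)) -(sum_half_card cc co cP).
  by rewrite natr_prod expr_sum mulrC -big_split /= big_seq.
under eq_fun do rewrite E.
rewrite /limit_term big_seq.
apply: (@cvg_big R _ (@GRing.mul R) 1 (fun u => u \in labels s) mul_continuous _ _ (labels s)
  (fun u N => 'C(width N u, half_card s u)%:R * N%:R^-1 ^+ half_card s u)) => u uU.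
by apply: (@cvg_bin _ _ _ 2) => N; exact: width_dist.
Qed.

Lemma clt_rhsE m : clt_rhs m s t =
  \sum_(k < n.+1) \sum_(c : {ffun 'I_n -> 'I_k} | ONC2 c m)
    (if compatb s c then limit_term else 0).
Proof.
rewrite /clt_rhs (prod_sigma st sep (fun B => ((#|B| %/ 2)`!)%:R)) mulr_sumr.
apply: eq_bigr => k _; rewrite mulr_sumr -big_mkcondr /=.
apply: eq_big => [c|c /andP[/andP[/and3P[co _ _] cP]]].
  by rewrite (compatibleP st sep).
rewrite (compatibleP st sep) => cc; rewrite (prod_ip st sep cc co cP s_ge0).
by rewrite /limit_term big_split /= mulrC prodfV.
Qed.

Lemma cvg_good m (M : nat -> nat) : (forall N x, hi N x < M N)%N ->
  scale N * (\sum_(i : {ffun 'I_n -> 'I_(M N)} | in_range N i) good m (word i))%N%:R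
    @[N --> \oo] --> clt_rhs m s t.
Proof.
move=> hM; rewrite clt_rhsE.
under eq_fun do rewrite sum_good natr_sum mulr_sumr.
apply: (cvg_big (op := +%R)) => [|k _]; first exact: add_continuous.
under eq_fun do rewrite natr_sum mulr_sumr.
apply: (cvg_big (op := +%R)) => [|c /andP[/and3P[co _ _] cP]]; first exact: add_continuous.
exact: cvg_compat.
Qed.

Definition index_bound N : nat := (\max_x hi N x).+1.

Lemma hi_index_bound N x : (hi N x < index_bound N)%N.
Proof. by rewrite ltnS (leq_bigmax x). Qed.

Lemma index_bound_le N : (0 < N)%N -> (index_bound N)%:R <= (1 + \sum_x t x) * N%:R :> R.
Proof.
move=> N0; rewrite mulrDl mul1r /index_bound -natr1 addrC lerD //; first by rewrite ler1n.
have t0 x : 0 <= t x by rewrite (le_trans (s_ge0 x)) // ltW.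
elim/big_ind: _ => [|a b ha hb|x _].
- by rewrite mulr_ge0 // sumr_ge0.
- by rewrite /maxn; case: ifP.
apply: le_trans (_ : t x * N%:R <= _); first by rewrite truncn_le mulr_ge0.
by rewrite ler_wpM2r // (bigD1 x) //= lerDl sumr_ge0.
Qed.

(** At most [d ^ n * M ^ d] words have [d] values, and [M <= K * N]. After scaling this is of order
    [N ^ (d - n / 2)], at most [N ^ (- 1 / 2)] when [2 * d < n]. *)
Lemma few_values : exists C : R, forall N, (0 < N)%N ->
  scale N * #|[set i : {ffun 'I_n -> 'I_(index_bound N)} | (#|ffun_image i|.*2 < n)%N]%SET|%:R
    <= C * (Num.sqrt N%:R)^-1.
Proof.
pose K : R := 1 + \sum_x t x.
have t0 x : 0 <= t x by rewrite (le_trans (s_ge0 x)) // ltW.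
have K0 : 0 <= K by rewrite addr_ge0 // sumr_ge0.
exists (\sum_(d < n | (d.*2 < n)%N) (d ^ n)%N%:R * K ^+ d) => N N0.
have hN : 1 <= N%:R :> R by rewrite ler1n.
have r0 : 0 < Num.sqrt N%:R :> R by rewrite sqrtr_gt0 (lt_le_trans ltr01).
have r1 : (Num.sqrt N%:R)^-1 <= 1 :> R.
  by rewrite invf_le1 // -[X in X <= _](sqrtr1 R) ler_sqrt // (lt_le_trans ltr01).
have le1 : (#|[set i : {ffun 'I_n -> 'I_(index_bound N)} | (#|ffun_image i|.*2 < n)%N]%SET| <=
    \sum_(d < n | (d.*2 < n)%N) d ^ n * index_bound N ^ d)%N.
  apply: (@leq_trans (\sum_(d < n | (d.*2 < n)%N)
      #|[set i : {ffun 'I_n -> 'I_(index_bound N)} | #|ffun_image i| == d]%SET|)%N); last first.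
    by apply: leq_sum => d _; exact: card_ffun_image_eq.
  rewrite -sum1_card big_mkcond /=.
  under [leqRHS]eq_bigr => d _ do rewrite -sum1_card big_mkcond /=.
  rewrite exchange_big /=; apply: leq_sum => i _; rewrite inE; case: ifP => // h.
  have hd : (#|ffun_image i| < n)%N by apply: leq_ltn_trans h; rewrite -addnn leq_addr.
  by rewrite (bigD1 (Ordinal hd)) //= inE eqxx.
apply: (@le_trans _ _ (scale N * (\sum_(d < n | (d.*2 < n)%N) d ^ n * index_bound N ^ d)%N%:R)).
  by rewrite ler_wpM2l ?ler_nat // /scale exprn_ge0 // invr_ge0 ltW.
rewrite natr_sum mulr_sumr mulr_suml; apply: ler_sum => d dn.
rewrite natrM mulrCA -mulrA ler_wpM2l // natrX.
apply: (@le_trans _ _ (scale N * (K * N%:R) ^+ d)).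
  rewrite ler_wpM2l ?lerXn2r ?nnegrE ?mulr_ge0 //; first by rewrite /scale exprn_ge0 // invr_ge0 ltW.
  exact: index_bound_le.
rewrite exprMn mulrCA ler_wpM2l ?exprn_ge0 //.
(* In powers of [sqrt N], the factor left over is [(sqrt N)^-1] to the power [n - 2 * d >= 1]. *)
have -> : N%:R ^+ d = Num.sqrt N%:R ^+ d.*2 :> R by rewrite -mul2n exprM sqr_sqrtr ?ler0n.
have -> : scale N = (Num.sqrt N%:R)^-1 ^+ (n - d.*2) * (Num.sqrt N%:R)^-1 ^+ d.*2.
  by rewrite -exprD subnK // ltnW.
rewrite -mulrA -exprMn mulVf ?gt_eqF // expr1n mulr1.
rewrite -subn_gt0 in dn; case: (n - d.*2)%N dn => // e _.
by rewrite exprS ler_piMr ?invr_ge0 ?exprn_ile1 ?invr_ge0 // ltW.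
Qed.

End Asymptotics.

(** Pair words contribute no error and words with a singleton vanish on both sides. Each remaining
    word has fewer than [n / 2] values and costs at most [B]. *)
Lemma pairword_sum (R : realType) (n M : nat) (m : nat) (f : seq nat -> R[i]) (B : R)
    (Q : pred {ffun 'I_n -> 'I_M}) :
  (forall w z, count_mem z w = 1%N -> f w = 0) ->
  (forall w, pairword w -> f w = (good m w)%:R) ->
  (forall w, size w = n -> `|f w| <= B%:C) ->
  `|\sum_(i | Q i) f (word i) - (\sum_(i | Q i) good m (word i))%N%:R| <=
  (B * #|[set i : {ffun 'I_n -> 'I_M} | (#|ffun_image i|.*2 < n)%N]%SET|%:R)%:C.
Proof.
move=> f1 f2 fB; rewrite natr_sum -sumrB.
have B0 (i : {ffun 'I_n -> 'I_M}) : 0 <= B%:C.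
  by apply: le_trans (fB (word i) _); rewrite ?normr_ge0 // size_map size_enum_ord.
apply: le_trans (ler_norm_sum _ _ _) _.
have h (i : {ffun 'I_n -> 'I_M}) : `|f (word i) - (good m (word i))%:R| <=
    if (#|ffun_image i|.*2 < n)%N then B%:C else 0.
  have [pw|np] := boolP (pairword (word i)).
    by rewrite f2 // subrr normr0; case: ifP => // _; exact: B0 i.
  have -> : good m (word i) = false by rewrite /good (negbTE np).
  rewrite subr0; case: (pselect (exists z, count_mem z (word i) = 1%N)) => [[z /f1 ->]|nz].
    by rewrite normr0; case: ifP => // _; exact: B0 i.
  rewrite ffun_image_lt_half //; first by apply: fB; rewrite size_map size_enum_ord.
  by move=> z; apply/eqP => hz; apply: nz; exists z.
apply: le_trans (ler_sum _ (fun i _ => h i)) _.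
apply: (@le_trans _ _ (\sum_(i : {ffun 'I_n -> 'I_M}) if (#|ffun_image i|.*2 < n)%N then B%:C else 0)).
  rewrite [leRHS](bigID Q) /= lerDl sumr_ge0 // => i _; case: ifP => // _; exact: B0 i.
rewrite -big_mkcond /= sumr_const rmorphM /= rmorph_nat mulr_natr.
by rewrite cardsE.
Qed.

(** * From the moments of words to the moments of the sums *)

Section Moments.
Variables (R : realType) (A : algType R[i]) (star : A -> A) (phi : A -> R[i]).
Variables (m : nat) (X : nat -> A).
Hypothesis Hphi : ncps phi.
Hypothesis HX : mmonotone_elems m phi star X.
Hypothesis Hid : ident_distributed phi X.
Hypothesis HX1 : forall i, phi (X i) = 0.
Hypothesis HX2 : forall i, phi (X i ^+ 2) = 1.

Lemma moments :
  [/\ (forall w z, count_mem z w = 1%N -> word_moment phi X w = 0),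
      (forall w, pairword w -> word_moment phi X w = (good m w)%:R) &
      (forall n, exists B : R, forall w, size w = n -> `|word_moment phi X w| <= B%:C)].
Proof.
have [Asub [[HA [u Hu] Hker] HXA]] := HX.
have m0 : (0 < m)%N.
  (* For [m = 0] the unit in a word of length one is not removable, so [phi (u i) = 0]. *)
  rewrite lt0n; apply/eqP => m0.
  have [] := Hu.2 1%N 1%N (fun=> 0%N) (fun=> 0) isT isT => //.
  - by move=> k k1; rewrite ltnNge k1.
  - by move=> k k1 k2 []; apply/eqP; rewrite eqn_leq k1 k2.
  - by move=> k k1; rewrite ltnNge k1.
  move=> _ h; have : phi (u 0%N) = 0.
    rewrite -[RHS]h /prod_with_unit ?big_nat1 ?eqxx //.
    by rewrite m0 => -[//|[r [[_ r1 r2] _ _ _]]]; move: r1; rewrite leqNgt r2.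
  by have [_ _ ->] := Hu.1 0%N; move/eqP; rewrite oner_eq0.
split.
- exact: (word_moment_singleton Hphi HA Hu Hker HXA Hid m0 HX1).
- move=> w pw; have := @word_moment_stack _ m (word_moment phi X) _ _ _ [::] w pw isT.
  rewrite /rev /= stack_runE // /good pw; apply.
  + exact: word_moment_nil.
  + exact: (word_moment_alternating Hphi HA Hu Hker HXA Hid HX1).
  move=> w1 w2 x ax x1 x2; rewrite (word_moment_pair Hphi HA Hu Hker HXA Hid m0 HX1 HX2 ax x1 x2).
  (* On a stack shorter than [m] at most one letter survives the [drop], so sortedness holds by
     itself and both criteria agree. *)
  congr (_%:R * _); rewrite /unit_survives; case: ltnP => // wm.
  have : (size (drop m.-1 (rcons w1 x)) <= 1)%N by rewrite size_drop size_rcons; lia.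
  by case: (drop _ _) => [|? []].
exact: (word_moment_bounded Hphi HA Hu Hker HXA Hid m0).
Qed.

Lemma sum_range M a b (F : nat -> A) : (b < M)%N ->
  \sum_(a.+1 <= k < b.+1) F k = \sum_(k < M | (a < k <= b)%N) F k.
Proof.
move=> bM; rewrite (big_nat_widenl _ 0) // (big_nat_widen _ _ M) //= big_mkord.
by apply: eq_bigl => k; rewrite ltnS.
Qed.

(** Multilinear expansion; [M] is any bound beyond the last index, so that the words form a finite
    type. *)
Lemma phi_prod_S N M n (s t : 'I_n -> R) : (forall x, Num.truncn (t x * N%:R) < M)%N ->
  phi (\prod_(j < n) S_N X N (s j) (t j)) =
  (scale R n N)%:C * \sum_(i : {ffun 'I_n -> 'I_M} | in_range s t N i) word_moment phi X (word i).
Proof.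
move=> hM.
have E : \prod_(j < n) S_N X N (s j) (t j) = (scale R n N)%:C *:
    \sum_(i : {ffun 'I_n -> 'I_M} | in_range s t N i) \prod_(k <- word i) X k.
  rewrite /S_N scaler_prod prodr_const card_ord /scale rmorphXn /=; congr (_ *: _).
  under eq_bigr => j _ do rewrite (@sum_range M) //.
  rewrite bigA_distr_big_dep; apply: eq_big => [i|i _].
    by apply/familyP/forallP => h x; exact: (h x).
  by rewrite /word big_map enumT [index_enum _]unlock.
by rewrite E (phiZ Hphi) (phi_sum Hphi).
Qed.

End Moments.

Theorem theorem9p1 (R : realType) (A : algType R[i]) (star : A -> A)
    (phi : A -> R[i]) (m : nat) (X : nat -> A) :
  is_star star -> ncps phi ->
  mmonotone_elems m phi star X ->
  ident_distributed phi X ->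
  (forall i, phi (X i) = 0) ->
  (forall i, phi (X i ^+ 2) = 1) ->
  forall (n : nat) (s t : 'I_n -> R),
    (forall j, in_Theta (s j) (t j)) ->
    (forall j l, chi (s j) (t j) = chi (s l) (t l) \/
                 (supp (chi (s j) (t j)) `&` supp (chi (s l) (t l)) = set0)%classic) ->
    forall eps : R, 0 < eps ->
      exists N0 : nat, forall N : nat, (N0 <= N)%N ->
        `| phi (\prod_(j < n) S_N X N (s j) (t j)) - (clt_rhs m s t)%:C | < eps%:C.
Proof.
move=> _ Hphi HX Hid HX1 HX2 n s t Hth Hsep eps eps0.
have s_ge0 j : 0 <= s j by have [] := Hth j.
have st j : s j < t j by have [] := Hth j.
have sep j l : (s j = s l /\ t j = t l) \/ t j <= s l \/ t l <= s j.
  by case: (Hsep j l) => [/chi_inj|/chi_disjoint] h; [left|right]; exact: h.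
have [f1 f2 fB] := moments Hphi HX Hid HX1 HX2.
have [B HB] := fB n.
have B0 : 0 <= B.
  by rewrite -lecR; apply: le_trans (HB (nseq n 0%N) (size_nseq _ _)); exact: normr_ge0.
have [C HC] := few_values s_ge0 st.
have e2 : 0 < eps / 2 by rewrite divr_gt0.
have [N1 HN1] := inv_sqrt_small (B * C) e2.
have /cvgrPdist_lt /(_ _ e2) [N2 _ HN2] := cvg_good s_ge0 st sep (m := m) (hi_index_bound t).
(* The 1 makes [N] positive, as [few_values] requires. *)
exists (maxn 1 (maxn N1 N2)) => N; rewrite !geq_max => /and3P[N0 /HN1 h1 /HN2 /= h2].
rewrite (phi_prod_S X Hphi (M := index_bound t N)); last exact: hi_index_bound.
set S1 := \sum_(i | _) _; set S2 := (\sum_(i | _) _)%N in h2.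
(* The error splits into the words that are not pairings and the convergence of the pairing count;
   each gets [eps / 2]. *)
have -> : (scale R n N)%:C * S1 - (clt_rhs m s t)%:C =
    (scale R n N)%:C * (S1 - S2%:R) + (scale R n N * S2%:R - clt_rhs m s t)%:C.
  have h : (scale R n N * S2%:R)%:C = (scale R n N)%:C * S2%:R by rewrite rmorphM /= rmorph_nat.
  by rewrite rmorphB /= h mulrBr addrA subrK.
apply: le_lt_trans (ler_normD _ _) _.
have -> : eps%:C = (eps / 2)%:C + (eps / 2)%:C by rewrite -rmorphD /= -splitr.
apply: ltr_leD.
  have c0 : 0 <= scale R n N by rewrite /scale exprn_ge0 // invr_ge0 sqrtr_ge0.
  rewrite normrM ger0_norm ?lecR //.
  have le1 := pairword_sum (in_range s t N (M := index_bound t N)) f1 f2 HB.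
  apply: le_lt_trans (ler_wpM2l _ le1) _; first by rewrite lecR.
  rewrite -rmorphM ltcR /=; apply: le_lt_trans h1.
  by rewrite mulrCA -mulrA ler_wpM2l // HC.
have -> : `|(scale R n N * S2%:R - clt_rhs m s t)%:C| =
    `|scale R n N * S2%:R - clt_rhs m s t|%:C.
  by rewrite normc_def /= expr0n addr0 sqrtr_sqr.
by rewrite lecR distrC ltW.
Qed.
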